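(* Let $L\to\widetilde L$ be a projective change of Finsler structures on an $n$-dimensional manifold $M$ with projective factor $\lambda$ ($\widetilde G=G-2\lambda\,\mathcal C$) satisfying $$\stackrel{2}{D^\circ}\alpha=-\frac1{n+1}\,p .$$ Then $(M,L)$ is $hv$-projectively flat under this change (i.e. the $hv$-curvature tensor $\widetilde P^\circ$ of the Berwald connection of $(M,\widetilde L)$ vanishes) if, and only if, $(M,L)$ is a Douglas manifold (i.e. its Douglas tensor $\mathbb P$ vanishes identically).
   Context: $M$ is a real paracompact $C^\infty$ manifold of dimension $n$; $\pi:\mathcal TM\to M$ is the bundle of nonzero tangent vectors; $\pi^{-1}(TM)\to\mathcal TM$ is the pullback of $TM$ by $\pi$. Sections of $\pi^{-1}(TM)$ are called $\pi$-vector fields and written $\overline X$; tensor fields on $\pi^{-1}(TM)$ are called $\pi$-tensor fields (scalar-valued covariant ones: $\pi$-forms). $\overline\eta$ is the $\pi$-vector field $\overline\eta(u)=(u,u)$. There is an exact sequence $0\to\pi^{-1}(TM)\xrightarrow{\gamma}T(\mathcal TM)\xrightarrow{\rho}\pi^{-1}(TM)\to0$, where $\gamma$ is the vertical lift $\gamma(u,w)=\frac{d}{dt}\big|_{t=0}(u+tw)$ and $\rho$ sends $X\in T_u(\mathcal TM)$ to $(u,d\pi(X))$. Put $J:=\gamma\circ\rho$ and $\mathcal C:=\gamma\circ\overline\eta$. For a function $f$, $d_Jf(X)=(JX)\cdot f$. For a Finsler manifold $(M,L)$ with $E=\frac12L^2$: the canonical spray $G$ is the vector field with $i_G\,dd_JE=-dE$;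 the Barthel connection is $\Gamma=[J,G]$, i.e. $\Gamma(X)=[JX,G]-J[X,G]$; $h=\frac12(I+\Gamma)$, $v=\frac12(I-\Gamma)$. The horizontal map $\beta:\pi^{-1}(TM)\to T(\mathcal TM)$ sends $\overline X$ to the unique vector in the image of $h$ with $\rho(\beta\overline X)=\overline X$; $K:T(\mathcal TM)\to\pi^{-1}(TM)$ is determined by $\gamma\circ K=v$. The Berwald connection $D^\circ$ is the linear connection on $\pi^{-1}(TM)$ with $D^\circ_{\gamma\overline X}\overline Y=\rho[\gamma\overline X,\beta\overline Y]$ and $D^\circ_{\beta\overline X}\overline Y=K[\beta\overline X,\gamma\overline Y]$. For a $\pi$-tensor field $A$, $(\stackrel{2}{D^\circ}A)(\overline X,\overline Y,\dots):=(D^\circ_{\gamma\overline X}A)(\overline Y,\dots)$. Curvature: $\mathbf K(X,Y)\overline Z=-D^\circ_XD^\circ_Y\overline Z+D^\circ_YD^\circ_X\overline Z+D^\circ_{[X,Y]}\overline Z$; $P^\circ(\overline X,\overline Y)\overline Z=\mathbf K(\beta\overline X,\gamma\overline Y)\overline Z$; $p(\overline X,\overline Y):=\mathrm{Tr}\{\overline Z\mapsto P^\circ(\overline X,\overline Y)\overline Z\}$. Douglas tensor: $\mathbb P(\overline X,\overline Y)\overline Z:=P^\circ(\overline X,\overline Y)\overline Z-\frac1{n+1}\mathfrak S_{\overline X,\overline Y,\overline Z}\{p(\overline X,\overline Y)\overline Z\}-\frac1{n+1}(D^\circ_{\gamma\overline Y}p)(\overline X,\overline Z)\,\overline\eta$,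 with $\mathfrak S$ the cyclic sum. Projective change: a change $L\to\widetilde L$ of Finsler structures on $M$ whose canonical sprays satisfy $\widetilde G=G-2\lambda\mathcal C$ for a function $\lambda$ on $TM$ (smooth on $\mathcal TM$) positively homogeneous of degree 1 in $y$. Put $\alpha(\overline X):=d_J\lambda(\beta\overline X)$. Tilded objects are those of $(M,\widetilde L)$, untilded ones those of $(M,L)$. *)

(* Defs.v *)
From mathcomp Require Import all_boot all_order all_algebra.
From mathcomp Require Import all_classical all_reals all_analysis.

Set Implicit Arguments.
Unset Strict Implicit.
Unset Printing Implicit Defensive.

Import Order.TTheory GRing.Theory Num.Theory numFieldNormedType.Exports.
Local Open Scope classical_set_scope.
Local Open Scope ring_scope.

(* [f] is C^oo on the open set [W]: every iterated directional derivative of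
   [f] is (Frechet-)differentiable at every point of [W]. *)
Definition iter_derive (R : realType) (E F : normedModType R)
    (f : E -> F) (s : seq E) : E -> F :=
  foldr (fun v g x => 'D_v g x) f s.

Definition smooth_on (R : realType) (E F : normedModType R)
    (W : set E) (f : E -> F) : Prop :=
  forall (s : seq E) (x : E), W x -> differentiable (iter_derive f s) x.

(* [inv_chart i] only matters on the image of [source i], [chart i] only on
   [source i].  [chart_at p] is a distinguished chart around [p]; the tangent
   space at [p] is the model space [E], a vector being identified with its
   components in the chart [chart_at p]. *)
Record atlas (R : realType) (X : Type) (E : normedModType R) := Atlas {
  chart_index : Type;
  source : chart_index -> set X;
  chart : chart_index -> X -> E;
  inv_chart : chart_index -> E -> X;
  chart_at : X -> chart_index }.

Arguments chart_index {R X E} a.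
Arguments source {R X E} a i _.
Arguments chart {R X E} a i _.
Arguments inv_chart {R X E} a i _.
Arguments chart_at {R X E} a _.

Section Paracompact.
Context (M : topologicalType).

Definition open_cover (I : Type) (U : I -> set M) : Prop :=
  (forall i, open (U i)) /\ \bigcup_i U i = setT.

Definition locally_finite (I : Type) (U : I -> set M) : Prop :=
  forall x : M, exists2 N, nbhs x N & finite_set [set i | N `&` U i !=set0].

Definition paracompact : Prop :=
  forall (I : Type) (U : I -> set M), open_cover U ->
  exists J : Type, exists V : J -> set M,
    [/\ open_cover V, locally_finite V & forall j, exists i, V j `<=` U i].

End Paracompact.

Record smooth_manifold (R : realType) (n : nat) (M : topologicalType)
    (A : atlas M 'rV[R]_n) : Prop := {
  mfd_hausdorff : hausdorff_space M;
  mfd_paracompact : paracompact M;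
  mfd_chart_at : forall p, source A (chart_at A p) p;
  mfd_chartK : forall i p, source A i p -> inv_chart A i (chart A i p) = p;
  mfd_open_source : forall i, open (source A i);
  mfd_open_target : forall i, open (chart A i @` source A i);
  mfd_chart_cont : forall i, {in source A i, continuous (chart A i)};
  mfd_inv_chart_cont : forall i,
    {in chart A i @` source A i, continuous (inv_chart A i)};
  mfd_transition : forall i j,
    smooth_on (chart A i @` (source A i `&` source A j))
      (chart A j \o inv_chart A i) }.

Section AtlasCalculus.
Context (R : realType) (X : Type) (E : normedModType R) (A : atlas X E).

Definition atlas_open (W : set X) : Prop :=
  forall i, open (chart A i @` (source A i `&` W)).

(* Components in the chart [i] of the tangent vector [v] at [p]. *)
Definition components (i : chart_index A) (p : X) (v : E) : E :=
  'D_v (chart A i \o inv_chart A (chart_at A p)) (chart A (chart_at A p) p).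

Definition smooth_fun (F : normedModType R) (W : set X) (f : X -> F) : Prop :=
  forall i, smooth_on (chart A i @` (source A i `&` W)) (f \o inv_chart A i).

Definition smooth_vfield (W : set X) (V : X -> E) : Prop :=
  forall i, smooth_on (chart A i @` (source A i `&` W))
    (fun z => components i (inv_chart A i z) (V (inv_chart A i z))).

Definition vderive (V : X -> E) (f : X -> R) (p : X) : R :=
  'D_(V p) (f \o inv_chart A (chart_at A p) : E -> R^o)
    (chart A (chart_at A p) p).

Definition lie_bracket (V W : X -> E) (p : X) : E :=
  xget 0 [set w | forall (U : set X) (f : X -> R),
    atlas_open U -> U p -> smooth_fun U (f : X -> R^o) ->
    vderive (fun=> w) f p
      = vderive V (vderive W f) p - vderive W (vderive V f) p].

Definition ext_deriv (w : (X -> E) -> X -> R) (V W : X -> E) (p : X) : R :=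
  vderive V (w W) p - vderive W (w V) p - w (lie_bracket V W) p.

(* A point of the tangent bundle is a pair (p, v) with v a tangent vector
   at p; the chart induced by [i] is (p, v) |-> (i p, components of v in i). *)
Definition tangent_atlas : atlas (X * E)%type (E * E)%type := {|
  chart_index := chart_index A;
  source := fun i => [set u | source A i u.1];
  chart := fun i u => (chart A i u.1, components i u.1 u.2);
  inv_chart := fun i z => let p := inv_chart A i z.1 in
    (p, 'D_(z.2) (chart A (chart_at A p) \o inv_chart A i) z.1);
  chart_at := fun u => chart_at A u.1 |}.

End AtlasCalculus.

Definition tangent_map (R : realType) (X Y : Type) (E F : normedModType R)
    (A : atlas X E) (B : atlas Y F) (f : X -> Y) (p : X) (v : E) : F :=
  'D_v (chart B (chart_at B (f p)) \o f \o inv_chart A (chart_at A p))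
    (chart A (chart_at A p) p).

Section Finsler.
Context (R : realType) (n : nat) (M : topologicalType) (A : atlas M 'rV[R]_n).

Local Notation V := 'rV[R]_n.
Local Notation TM := (M * 'rV[R]_n)%type.
Local Notation TTM := ('rV[R]_n * 'rV[R]_n)%type.
Local Notation TA := (tangent_atlas A).

(* Vector fields on TM and pi-vector fields are total functions; only their
   values on an open subset of the bundle of nonzero vectors matter. *)
Local Notation vfield := (TM -> TTM).
Local Notation pifield := (TM -> V).

Definition slit : set TM := [set u | u.2 != 0].

Definition local_domain (W : set TM) : Prop :=
  atlas_open TA W /\ W `<=` slit.

Definition smooth_pifield (W : set TM) (Y : pifield) : Prop :=
  forall i, smooth_on (chart TA i @` (source TA i `&` W))
    (fun z => let u := inv_chart TA i z in components (A := A) i u.1 (Y u)).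

Definition vlift (u : TM) (w : V) : TTM :=
  derive1 (fun t : R => chart TA (chart_at TA u) (u.1, u.2 + t *: w)) 0.

Definition rho (u : TM) (xi : TTM) : V :=
  tangent_map TA A (fst : TM -> M) u xi.

Definition eta : pifield := fun u => u.2.

Definition gammaF (Y : pifield) : vfield := fun u => vlift u (Y u).

Definition rhoF (X : vfield) : pifield := fun u => rho u (X u).

Definition J (X : vfield) : vfield := gammaF (rhoF X).

Definition liouville : vfield := gammaF eta.

Definition d_J (f : TM -> R) (X : vfield) : TM -> R := vderive TA (J X) f.

Definition energy (L : TM -> R) : TM -> R := fun u => 2^-1 * L u ^+ 2.

Definition hilbert_form (L : TM -> R) : vfield -> vfield -> TM -> R :=
  ext_deriv TA (d_J (energy L)).

Definition positively_homogeneous (f : TM -> R) : Prop :=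
  forall p v (t : R), 0 < t -> f (p, t *: v) = t * f (p, v).

Record finsler (L : TM -> R) : Prop := {
  finsler_cont : forall i, {in chart TA i @` source TA i,
    continuous (L \o inv_chart TA i : TTM -> R^o)};
  finsler_smooth : smooth_fun TA slit (L : TM -> R^o);
  finsler_pos : forall u, slit u -> 0 < L u;
  finsler_homogeneous : positively_homogeneous L;
  finsler_nondegenerate : forall (W : set TM) (X : vfield) (u : TM),
    local_domain W -> smooth_vfield TA W X -> W u ->
    (forall (W' : set TM) (Y : vfield), local_domain W' ->
       smooth_vfield TA W' Y -> W' u -> hilbert_form L X Y u = 0) ->
    X u = 0 }.

(* i_G dd_J E = - dE; the 2-form dd_J E is evaluated on local vector fields. *)
Definition canonical_spray (L : TM -> R) (G : vfield) : Prop :=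
  smooth_vfield TA slit G /\
  forall (W : set TM) (X : vfield), local_domain W -> smooth_vfield TA W X ->
  forall u, W u -> hilbert_form L G X u = - vderive TA X (energy L) u.

(* Everything up to the Douglas tensor depends on (M, L) only through its
   canonical spray G. *)
Section Spray.
Context (G : vfield).

Definition barthel (X : vfield) : vfield := fun u =>
  lie_bracket TA (J X) G u - J (lie_bracket TA X G) u.

Definition hproj (X : vfield) : vfield := fun u =>
  2^-1 *: (X u + barthel X u).

Definition vproj (X : vfield) : vfield := fun u =>
  2^-1 *: (X u - barthel X u).

Definition beta (Y : pifield) : vfield := fun u =>
  xget 0 [set xi | (exists W X, [/\ local_domain W, W u,
                      smooth_vfield TA W X & xi = hproj X u])
                   /\ rho u xi = Y u].

Definition K (X : vfield) : pifield := fun u =>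
  xget 0 [set w | vlift u w = vproj X u].

(* X = gamma (K X) + beta (rho X). *)
Definition berwald (X : vfield) (Y : pifield) : pifield := fun u =>
  rhoF (lie_bracket TA (gammaF (K X)) (beta Y)) u
  + K (lie_bracket TA (beta (rhoF X)) (gammaF Y)) u.

Definition curvature (X Y : vfield) (Z : pifield) : pifield := fun u =>
  - berwald X (berwald Y Z) u + berwald Y (berwald X Z) u
  + berwald (lie_bracket TA X Y) Z u.

Definition hv_curvature (X Y Z : pifield) : pifield :=
  curvature (beta X) (gammaF Y) Z.

(* Trace of the endomorphism of the fibre of the pullback bundle over [u]
   induced by [Phi], an expression tensorial in its pi-vector field. *)
Definition fibre_trace (u : TM) (Phi : pifield -> V) : R :=
  \tr (xget 0 [set T : 'M[R]_n | forall W Z, local_domain W -> W u ->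
         smooth_pifield W Z -> Phi Z = Z u *m T]).

Definition hv_trace (X Y : pifield) : TM -> R := fun u =>
  fibre_trace u (fun Z => hv_curvature X Y Z u).

(* Covariant derivatives of scalar pi-forms of degree 1 and 2. *)
Definition berwald_form1 (X : vfield) (w : pifield -> TM -> R)
    (Y : pifield) : TM -> R := fun u =>
  vderive TA X (w Y) u - w (berwald X Y) u.

Definition berwald_form2 (X : vfield) (w : pifield -> pifield -> TM -> R)
    (Y Z : pifield) : TM -> R := fun u =>
  vderive TA X (w Y Z) u - w (berwald X Y) Z u - w Y (berwald X Z) u.

Definition douglas (X Y Z : pifield) : pifield := fun u =>
  hv_curvature X Y Z u
  - n.+1%:R^-1 *: (hv_trace X Y u *: Z u + hv_trace Y Z u *: X u
                   + hv_trace Z X u *: Y u)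
  - (n.+1%:R^-1 * berwald_form2 (gammaF Y) hv_trace X Z u) *: eta u.

Definition hv_curvature_vanishes : Prop :=
  forall (W : set TM) (X Y Z : pifield), local_domain W ->
  smooth_pifield W X -> smooth_pifield W Y -> smooth_pifield W Z ->
  forall u, W u -> hv_curvature X Y Z u = 0.

Definition douglas_manifold : Prop :=
  forall (W : set TM) (X Y Z : pifield), local_domain W ->
  smooth_pifield W X -> smooth_pifield W Y -> smooth_pifield W Z ->
  forall u, W u -> douglas X Y Z u = 0.

Definition proj_form (lambda : TM -> R) (X : pifield) : TM -> R :=
  d_J lambda (beta X).

End Spray.

Definition projective_factor (G Gt : vfield) (lambda : TM -> R) : Prop :=
  [/\ smooth_fun TA slit (lambda : TM -> R^o),
      positively_homogeneous lambda &
      forall u, slit u -> Gt u = G u - (2 * lambda u) *: liouville u].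

(* Vertical Berwald derivative of alpha = d_J lambda o beta equals
   - p / (n + 1). *)
Definition alpha_condition (G : vfield) (lambda : TM -> R) : Prop :=
  forall (W : set TM) (X Y : pifield), local_domain W ->
  smooth_pifield W X -> smooth_pifield W Y ->
  forall u, W u ->
    berwald_form1 G (gammaF X) (proj_form G lambda) Y u
      = - n.+1%:R^-1 * hv_trace G X Y u.

End Finsler.

(* Main.v *)
Require Import Defs.
From HB Require Import structures.
From mathcomp Require Import all_boot all_order all_algebra.
From mathcomp Require Import all_classical all_reals all_analysis.
From mathcomp Require Import ring lra.

(** In the coordinates (x, y) that a chart induces on the tangent bundle, a spray
    has the form G = (y, - 2 g). Its horizontal lift sends X to
    (X, - D_(0,X) g), and its Berwald connection is

      D_xi Y = (derivative of Y along xi) + D_(0,Y) D_(0,X) g,  X = rho xi,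

    that is, flat differentiation corrected by the second vertical derivative of
    g. Its hv-curvature is therefore the third vertical derivative of g: the value
    on X, Y, Z is g_XYZ (coord_curvature, local_hv_curvature).

    A projective change with factor lambda replaces g by g + lambda y. Since y is
    linear in the fibre, Leibniz' rule gives the new hv-curvature as

      g_XYZ + lambda_XYZ y + lambda_XY Z + lambda_YZ X + lambda_ZX Y

    (third_vert_projective). On the other hand the vertical derivative of alpha is
    the second vertical derivative of lambda, so the hypothesis reads
    p(X, Y) = - (n + 1) lambda_XY, and differentiating it once more gives
    (D_Y p)(X, Z) = - (n + 1) lambda_XYZ. Substituted in the definition of the
    Douglas tensor, these values produce the same expression. Hence the Douglas
    tensor of the first spray equals the hv-curvature of the second one
    (douglas_is_projective_hv_curvature), and the equivalence is immediate.

    Three facts support these computations. The Lie bracket, characterized by its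
    action on functions, has its classical expression in a chart (lie_bracketE);
    this rests on the symmetry of second derivatives (schwarz), obtained from the
    mean value theorem. The tangent bundle of a manifold carries an atlas to which
    the same calculus applies (tangent_smooth_atlas). And the x-components of the
    canonical spray are y (spray_is_semispray): its defining equation, tested on
    vertical fields and compared with Euler's relation for the energy, puts the
    difference in the kernel of a nondegenerate form. *)

Set Implicit Arguments.
Unset Strict Implicit.
Unset Printing Implicit Defensive.

Import Order.TTheory GRing.Theory Num.Theory numFieldNormedType.Exports.
Local Open Scope classical_set_scope.
Local Open Scope ring_scope.

(** * Directional derivatives and linear maps *)

Section Calculus.
Context (R : realType).
Implicit Types E F G : normedModType R.

Lemma derive_comp E F G (f : E -> F) (g : F -> G) x v :
  differentiable f x -> differentiable g (f x) ->
  'D_v (g \o f) x = 'D_('D_v f x) g (f x).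
Proof.
move=> df dg; rewrite (deriveE _ (differentiable_comp df dg)) (deriveE _ df).
by rewrite (deriveE _ dg) (diff_comp df dg).
Qed.

Lemma derive_linD E F (f : E -> F) x u v : differentiable f x ->
  'D_(u + v) f x = 'D_u f x + 'D_v f x.
Proof. by move=> df; rewrite !(deriveE _ df) linearD. Qed.

Lemma derive_linB E F (f : E -> F) x u v : differentiable f x ->
  'D_(u - v) f x = 'D_u f x - 'D_v f x.
Proof. by move=> df; rewrite !(deriveE _ df) linearB. Qed.

Lemma derive_linZ E F (f : E -> F) x k v : differentiable f x ->
  'D_(k *: v) f x = k *: 'D_v f x.
Proof. by move=> df; rewrite !(deriveE _ df) linearZ. Qed.

Lemma derive_lin_sum E F (f : E -> F) x n (v : 'I_n -> E) :
  differentiable f x -> 'D_(\sum_k v k) f x = \sum_k 'D_(v k) f x.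
Proof.
move=> df; rewrite (deriveE _ df) linear_sum.
by apply: eq_bigr => k _; rewrite deriveE.
Qed.

Lemma near_differentiable E F (f g : E -> F) x :
  (\near x, f x = g x) -> differentiable f x -> differentiable g x.
Proof.
move=> fg df.
have fgx : f x = g x := nbhs_singleton fg.
have H : g \o shift x = cst (g x) + 'd f x +o_ (0 : E) id.
  apply/eqaddoP => e e0.
  have /diff_locally/eqaddoP/(_ e e0) := df.
  have : \forall h \near (0 : E), f (h + x) = g (h + x).
    by move: fg; rewrite (near_shift (0 : E)); apply: filterS => h /=; rewrite subr0.
  apply: filterS2 => h /= fgh.
  by rewrite /shift /= !fctE /= fgh fgx.
have [cd _] := (diff_locallyP _ _).1 df.
by apply/diff_locallyP; rewrite (diff_unique cd H).
Qed.

(** A derivative in direction v only sees the function on the line through x,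
    so coordinates that are constant along v may be frozen. *)
Lemma derive_line E F (f : E -> F) x v :
  'D_v f x = 'D_1 (fun h : R => f (h *: v + x)) 0.
Proof.
rewrite /derive; set g1 := fun h => h^-1 *: _; set g2 := fun h => h^-1 *: _.
suff -> : g1 = g2 by [].
by apply/funext => h; rewrite /g1 /g2 /= addr0 scale0r add0r [_%:A]mulr1.
Qed.

Lemma open_near E F (W : set E) (f g : E -> F) x :
  open W -> W x -> (forall y, W y -> f y = g y) -> \near x, f x = g x.
Proof.
move=> oW Wx fg; apply: (@filterS _ _ _ W) => //.
by apply: open_nbhs_nbhs; split.
Qed.

(** Continuous linear maps, described by their derivative: linearity follows,
    and closure under composition and pairing is the chain rule. *)
Definition linmap E F (l : E -> F) : Prop :=
  (forall x, differentiable l x) /\ (forall x v, 'D_v l x = l v).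

Lemma linmapD E F (l : E -> F) : linmap l -> {morph l : u v / u + v}.
Proof. by case=> dl e u v; rewrite -!(e 0) derive_linD. Qed.

Lemma linmapB E F (l : E -> F) : linmap l -> {morph l : u v / u - v}.
Proof. by case=> dl e u v; rewrite -!(e 0) derive_linB. Qed.

Lemma linmapZ E F (l : E -> F) k : linmap l -> {morph l : u / k *: u}.
Proof. by case=> dl e u; rewrite -!(e 0) derive_linZ. Qed.

Lemma linmap_0 E F (l : E -> F) : linmap l -> l 0 = 0.
Proof. by case=> _ el; rewrite -(el 0) derive0. Qed.

Lemma linmap_linear E F (l : {linear E -> F}) : continuous l -> linmap l.
Proof.
move=> cl; have dl x := linear_differentiable x cl.
by split=> // x v; rewrite deriveE // diff_lin.
Qed.

Lemma linmap_comp E F G (l : E -> F) (m : F -> G) :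
  linmap l -> linmap m -> linmap (m \o l).
Proof.
move=> [dl el] [dm em]; split=> [x|x v]; first exact: differentiable_comp.
by rewrite derive_comp //= el em.
Qed.

Lemma derive_linmap E F G (f : E -> F) (l : F -> G) x v :
  linmap l -> differentiable f x -> 'D_v (l \o f) x = l ('D_v f x).
Proof. by move=> [dl el] df; rewrite derive_comp // el. Qed.

Lemma derive_pair E F G (f : E -> F) (g : E -> G) x v :
  differentiable f x -> differentiable g x ->
  'D_v (fun z => (f z, g z)) x = ('D_v f x, 'D_v g x).
Proof.
move=> df dg; rewrite (deriveE _ (differentiable_pair df dg)) diff_pair //.
by rewrite !deriveE.
Qed.

Lemma linmap_pair E F G (l : E -> F) (m : E -> G) :
  linmap l -> linmap m -> linmap (fun z => (l z, m z)).
Proof.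
move=> [dl el] [dm em]; split=> [x|x v]; first exact: differentiable_pair.
by rewrite derive_pair // el em.
Qed.

Lemma linmap_fst E F : linmap (fst : E * F -> E).
Proof. by apply: linmap_linear => x; apply: cvg_fst. Qed.

Lemma linmap_snd E F : linmap (snd : E * F -> F).
Proof. by apply: linmap_linear => x; apply: cvg_snd. Qed.

Lemma linmap_id E : linmap (id : E -> E).
Proof. by split=> [x|x v]; rewrite ?derive_id. Qed.

Lemma linmap_cst0 E F : linmap (cst 0 : E -> F).
Proof. by split=> [x|x v]; rewrite ?derive_cst. Qed.

(** In the coordinates (x, y) of a tangent bundle this is the vertical vector
    with y-components w. *)
Definition vert E (w : E) : E * E := (0, w).

Lemma linmap_vert E : linmap (@vert E).
Proof. exact: linmap_pair (linmap_cst0 _ _) (@linmap_id _). Qed.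

Lemma linmap_scale E k : linmap ( *:%R k : E -> E).
Proof. by split=> [x|x v]; rewrite ?deriveE // diff_val. Qed.

Lemma linmap_scalel E (e : E) : linmap ( *:%R^~ e : R^o -> E).
Proof. by split=> [x|x v]; rewrite ?deriveE // diff_val. Qed.

Lemma linmap_coord n (j : 'I_n) : linmap (fun v : 'rV[R]_n => v 0 j : R^o).
Proof.
have @f : {linear 'rV[R]_n -> R^o}.
  by exists (fun v : 'rV[R]_n => v 0 j : R^o); do 2![eexists]; do ?[constructor];
     rewrite ?mxE// => ? *; rewrite ?mxE//; move=> ?; rewrite !mxE.
by apply: (@linmap_linear _ _ f); exact: coord_continuous.
Qed.

Lemma linmap_derive E F (f : E -> F) x : differentiable f x ->
  linmap (fun v => 'D_v f x).
Proof.
move=> df; have -> : (fun v => 'D_v f x) = 'd f x :> (E -> F).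
  by apply/funext => v; rewrite deriveE.
by apply: linmap_linear; exact: diff_continuous.
Qed.

Let scale_bil E : bilinear_for
    (GRing.Scale.Law.clone _ _ *:%R _) (GRing.Scale.Law.clone _ _ *:%R _)
    (fun (a : R^o) (v : E) => a *: v).
Proof.
split => [v|u] a x y /=; first by rewrite scalerDl scalerA.
by rewrite scalerDr !scalerA mulrC.
Qed.

Lemma differentiable_scale E F (a : E -> R^o) (f : E -> F) x :
  differentiable a x -> differentiable f x ->
  differentiable (fun z => a z *: f z) x.
Proof.
move=> da df.
pose scM := bilinear_isBilinear.Build _ _ _ _ _ _ _ (@scale_bil F).
pose scL : {bilinear R^o -> F -> F} := HB.pack (fun (a : R^o) (v : F) => a *: v) scM.
have cs : continuous (fun p : R^o * F => scL p.1 p.2) by apply: scale_continuous.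
exact: (@differentiable_comp _ _ _ _ _ _ x (differentiable_pair da df)
  (@differentiable_bilin _ _ _ _ scL (a x, f x) cs)).
Qed.

Lemma derive_scale E F (a : E -> R^o) (f : E -> F) x v :
  differentiable a x -> differentiable f x ->
  'D_v (fun z => a z *: f z) x = 'D_v a x *: f x + a x *: 'D_v f x.
Proof.
move=> da df; rewrite (deriveE _ (differentiable_scale da df)).
pose scM := bilinear_isBilinear.Build _ _ _ _ _ _ _ (@scale_bil F).
pose scL : {bilinear R^o -> F -> F} := HB.pack (fun (a : R^o) (v : F) => a *: v) scM.
have cs : continuous (fun p : R^o * F => scL p.1 p.2) by apply: scale_continuous.
have ds := @differentiable_bilin _ _ _ _ scL (a x, f x) cs.
rewrite (@diff_comp _ _ _ _ _ _ x (differentiable_pair da df) ds) /=.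
rewrite (diff_bilin (a x, f x) cs) /= diff_pair //= !deriveE //.
by rewrite addrC.
Qed.

End Calculus.

(** * Symmetry of second derivatives *)

Section Schwarz.
Context (R : realType) (E : normedModType R).
Implicit Types (f : E -> R^o) (z a b : E).

(** Exchanging a and b does not change this quantity, which is the source of
    the symmetry of second derivatives. *)
Definition second_difference f z a b (t : R) : R :=
  f (z + t *: a + t *: b) - f (z + t *: a) - f (z + t *: b) + f z.

(** The mean value theorem along a turns the second difference into t times an
    increment of 'D_a f along t b, which differentiability of 'D_a f at z alone
    (Young's hypothesis) approximates by t ^+ 2 times the mixed derivative. *)
Lemma second_differenceP f z a b (e : R) :
  (\forall y \near z, differentiable f y) ->
  differentiable (fun y => 'D_a f y : R^o) z -> 0 < e ->
  exists2 d, 0 < d & forall t, 0 < t -> t < d ->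
    `|second_difference f z a b t - t ^+ 2 * 'D_b (fun y => 'D_a f y : R^o) z|
      <= e * t ^+ 2.
Proof.
move=> fz dfz e0.
set L := 'd (fun y => 'D_a f y : R^o) z.
(* the two points reached from z, x a + t b and x a with x < t, have norms
   whose sum is at most t C *)
set C : R := 2 * `|a| + `|b| + 1.
have C0 : 0 < C by rewrite /C; have := normr_ge0 a; have := normr_ge0 b; lra.
have [cL /eqaddoP Lo] := (diff_locallyP _ _).1 dfz.
have /nbhs_norm0P[r /= r0 Lr] := Lo _ (divr_gt0 e0 C0).
have /nbhs_normP[s /= s0 fs] := fz.
set q := Num.min r s.
have q0 : 0 < q by rewrite /q lt_min r0 s0.
exists (q / C); first exact: divr_gt0.
move=> t t0 tq.
have tC : t * C < q by rewrite -ltr_pdivlMr.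
have small x y : 0 <= x -> x <= t -> 0 <= y -> y <= t ->
    `|x *: a + y *: b| < q.
  move=> x0 xt y0 yt; apply: le_lt_trans tC.
  apply: le_trans (ler_normD _ _) _.
  rewrite !normrZ (ger0_norm x0) (ger0_norm y0) /C.
  have := normr_ge0 a; have := normr_ge0 b; nra.
have df x y : 0 <= x -> x <= t -> 0 <= y -> y <= t ->
    differentiable f (z + (x *: a + y *: b)).
  move=> x0 xt y0 yt; apply: fs; rewrite /ball_/= opprD addNKr normrN.
  by apply: (lt_le_trans (small _ _ _ _ _ _)); rewrite // /q ge_min lexx orbT.
(* phi t - phi 0 is the second difference *)
pose phi (x : R) : R := f (z + (x *: a + t *: b)) - f (z + (x *: a + 0 *: b)).
pose dphi (x : R) : R :=
  'D_a f (z + (x *: a + t *: b)) - 'D_a f (z + (x *: a + 0 *: b)).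
have dline x y : 0 <= x -> x <= t -> 0 <= y -> y <= t ->
  is_derive x 1 (fun x : R => f (z + (x *: a + y *: b)) : R)
     ('D_a f (z + (x *: a + y *: b))).
  move=> x0 xt y0 yt.
  have dl : is_diff x (fun x : R => z + (x *: a + y *: b)) ( *:%R^~ a).
    apply: is_diff_eq; apply/funext => h /=.
    by rewrite !fctE /= add0r addr0.
  have dfl := df x y x0 xt y0 yt.
  have dc : differentiable ((f : E -> R^o) \o (fun x : R => z + (x *: a + y *: b))) x.
    by apply: differentiable_comp.
  apply: DeriveDef; first exact: diff_derivable.
  rewrite -[LHS]/('D_1 (f \o (fun x : R => z + (x *: a + y *: b))) x).
  rewrite derive_comp //.
  rewrite [X in 'D_X f _]deriveE; last exact: ex_diff.
  by rewrite diff_val scale1r.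
have phi0 x : x \in `]0, t[%R -> is_derive x (1:R) phi (dphi x).
  rewrite in_itv/= => /andP[x0 xt].
  by apply: is_deriveB; apply: dline => //; apply: ltW.
have cphi : {within `[0, t], continuous phi}.
  apply: derivable_within_continuous => x; rewrite in_itv/= => /andP[x0 xt].
  by apply: derivableB; apply: (@ex_derive _ _ _ _ _ _ _ (dline _ _ _ _ _ _)) => //; exact: ltW.
have [x xin phiE] := MVT t0 phi0 cphi.
have -> : second_difference f z a b t = dphi x * t.
  move: phiE; rewrite subr0 => <-.
  by rewrite /phi /second_difference !scale0r !addr0 !add0r !addrA; ring.
move: xin; rewrite in_itv/= => /andP[x0 xt].
have ext y : 0 <= y -> y <= t ->
  `|'D_a f (z + (x *: a + y *: b)) - 'D_a f z - L (x *: a + y *: b)|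
     <= e / C * `|x *: a + y *: b|.
  move=> y0 yt; have := Lr (x *: a + y *: b).
  rewrite /= => /(_ _)/=.
  rewrite !fctE /shift /= opprD addrA [_ + z]addrC; apply.
  by apply: (lt_le_trans (small _ _ _ _ _ _)); rewrite // ?(ltW x0) ?(ltW xt) // /q ge_min lexx.
have := ext t (ltW t0) (lexx t); have := ext 0 (lexx 0) (ltW t0).
have -> : 'D_b (fun y => 'D_a f y : R^o) z = L b by rewrite deriveE.
rewrite scale0r addr0.
have -> : L (x *: a + t *: b) = x * L a + t * L b by rewrite linearD !linearZ.
have -> : L (x *: a) = x * L a by rewrite linearZ.
have na := normr_ge0 a; have nb := normr_ge0 b.
have n1 : `|x *: a + t *: b| <= t * `|a| + t * `|b|.
  apply: le_trans (ler_normD _ _) _.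
  rewrite !normrZ (gtr0_norm x0) (gtr0_norm t0).
  by rewrite lerD2r; apply: ler_wpM2r => //; exact: ltW.
have n2 : `|x *: a| <= t * `|a|.
  by rewrite normrZ (gtr0_norm x0); apply: ler_wpM2r => //; exact: ltW.
have eC : 0 < e / C by rewrite divr_gt0.
move=> h1 h2.
have {}h1 := le_trans h1 (ler_wpM2l (ltW eC) n2).
have {}h2 := le_trans h2 (ler_wpM2l (ltW eC) n1).
have : `|dphi x - t * L b| <= e * t.
  have -> : e * t = e / C * (t * C) by field; rewrite gt_eqF.
  have : e / C * (t * `|a|) + e / C * (t * `|a| + t * `|b|) <= e / C * (t * C).
    rewrite -mulrDr ler_wpM2l ?ltW// /C; nra.
  apply: le_trans.
  apply: le_trans (lerD h1 h2); rewrite [leRHS]addrC; apply: le_trans (ler_normB _ _).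
  rewrite /dphi scale0r addr0; rewrite le_eqVlt; apply/orP; left; apply/eqP.
  by congr (`| _ |); ring.
move=> h; rewrite (_ : _ - _ = (dphi x - t * L b) * t); last by ring.
by rewrite normrM (gtr0_norm t0) expr2 mulrA ler_wpM2r// ltW.
Qed.

(** Both mixed derivatives are limits of the same second difference divided by
    t ^+ 2. *)
Lemma schwarz_real f z a b :
  (\forall y \near z, differentiable f y) ->
  differentiable (fun y => 'D_a f y : R^o) z ->
  differentiable (fun y => 'D_b f y : R^o) z ->
  'D_b (fun y => 'D_a f y : R^o) z = 'D_a (fun y => 'D_b f y : R^o) z.
Proof.
move=> fz da db; apply/eqP; rewrite -subr_eq0 -normr_eq0.
set A := 'D_b _ z; set B := 'D_a _ z.
apply/eqP/le_anti/andP; split=> //; apply/ler_addgt0Pl => e e0; rewrite addr0.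
have e2 : 0 < e / 2 by lra.
have [r r0 Hr] := second_differenceP b fz da e2.
have [s s0 Hs] := second_differenceP a fz db e2.
pose t := Num.min r s / 2.
have m0 : 0 < Num.min r s by rewrite lt_min r0 s0.
have mr : Num.min r s <= r by rewrite ge_min lexx.
have ms : Num.min r s <= s by rewrite ge_min lexx orbT.
have t0 : 0 < t by rewrite /t; lra.
have tr : t < r by rewrite /t; lra.
have ts : t < s by rewrite /t; lra.
have sym : second_difference f z b a t = second_difference f z a b t.
  by rewrite /second_difference [z + _ + _]addrAC; ring.
have := Hr t t0 tr; have := Hs t t0 ts; rewrite sym -/A -/B => h1 h2.
have tt0 : 0 < t ^+ 2 by rewrite exprn_gt0.
rewrite -(ler_pM2l tt0) -{1}(gtr0_norm tt0) -normrM.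
have -> : t ^+ 2 * (A - B) = (second_difference f z a b t - t ^+ 2 * B)
   - (second_difference f z a b t - t ^+ 2 * A) by ring.
apply: le_trans (ler_normB _ _) _.
by apply: le_trans (lerD h1 h2) _; rewrite le_eqVlt; apply/orP; left; apply/eqP; field.
Qed.
End Schwarz.

(** * Expansions in a finite basis *)

Section Coordinates.
Context (R : realType).
Implicit Types E F G : normedModType R.

(** A basis e together with its dual coordinate functionals c. Finite
    dimension is what lets a derivative along a varying vector be written as a
    finite sum of derivatives along fixed ones. *)
Definition fin_dim E : Prop :=
  exists n (e : 'I_n -> E) (c : 'I_n -> E -> R^o),
    (forall k, linmap (c k)) /\ (forall v, v = \sum_k c k v *: e k).

Lemma fin_dim_rV n : fin_dim 'rV[R]_n.
Proof.
exists n, (fun j => delta_mx 0 j), (fun j (v : 'rV[R]_n) => v 0 j : R^o); split=> [k|v].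
  exact: linmap_coord.
exact: row_sum_delta.
Qed.

Lemma fin_dim_scalar : fin_dim R^o.
Proof.
exists 1%N, (fun=> 1 : R^o), (fun=> id); split=> [k|v]; first exact: linmap_id.
by rewrite big_ord1 [_ *: _]mulr1.
Qed.

Lemma fin_dim_prod E F : fin_dim E -> fin_dim F -> fin_dim (E * F)%type.
Proof.
move=> [n [e [c [lc ec]]]] [m [e' [c' [lc' ec']]]].
exists (n + m)%N,
  (fun k : 'I_(n + m) => match fintype.split k with
     inl i => (e i, 0) | inr j => (0, e' j) end),
  (fun (k : 'I_(n + m)) (v : E * F) => match fintype.split k with
     inl i => c i v.1 | inr j => c' j v.2 end : R^o).
split=> [k|[u v]].
  case: (fintype.split k) => i; [exact: linmap_comp (@linmap_fst R E F) (lc i)|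
                          exact: linmap_comp (@linmap_snd R E F) (lc' i)].
rewrite big_split_ord /=.
under eq_bigr do rewrite -/(unsplit (inl _)) unsplitK.
under [X in _ = _ + X]eq_bigr do rewrite -/(unsplit (inr _)) unsplitK.
rewrite {1}(ec u) {1}(ec' v).
have p1 (w : 'I_n -> E) : \sum_i (w i, 0 : F) = (\sum_i w i, 0).
  apply: (big_ind2 (fun (x : E * F) y => x = (y, 0))) => // x1 x2 y1 y2 -> ->.
  by congr (_, _); rewrite addr0.
have p2 (w : 'I_m -> F) : \sum_i (0 : E, w i) = (0, \sum_i w i).
  apply: (big_ind2 (fun (x : E * F) y => x = (0, y))) => // x1 x2 y1 y2 -> ->.
  by congr (_, _); rewrite addr0.
under eq_bigr do rewrite [_ *: _]surjective_pairing /= scaler0.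
under [X in _ = _ + X]eq_bigr do rewrite [_ *: _]surjective_pairing /= scaler0.
by rewrite p1 p2; congr (_, _); rewrite ?addr0 ?add0r.
Qed.

Lemma derive_in_basis E F n (e : 'I_n -> E) (c : 'I_n -> E -> R^o)
    (f : E -> F) x v :
  (forall v, v = \sum_k c k v *: e k) -> differentiable f x ->
  'D_v f x = \sum_k c k v *: 'D_(e k) f x.
Proof.
move=> ec df; rewrite {1}(ec v) derive_lin_sum //.
by apply: eq_bigr => k _; rewrite derive_linZ.
Qed.

Lemma derive_sumE E F n (f : 'I_n -> E -> F) x v :
  (forall k, differentiable (f k) x) ->
  differentiable (fun y => \sum_k f k y) x /\
  'D_v (fun y => \sum_k f k y) x = \sum_k 'D_v (f k) x.
Proof.
move=> df.
have -> : (fun y => \sum_k f k y) = \sum_k f k.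
  by apply/funext => y; rewrite fct_sumE.
split; first exact: differentiable_sum.
by rewrite derive_sum // => k; exact: diff_derivable.
Qed.

(** Leibniz' rule for the bilinear pairing of a vector field w with the
    differential of f: the second term freezes w at z. *)
Lemma derive_along E F (f : E -> F) (w : E -> E) z : fin_dim E ->
  (\forall y \near z, differentiable f y) ->
  (forall v, differentiable (fun y => 'D_v f y) z) ->
  differentiable w z ->
  differentiable (fun y => 'D_(w y) f y) z /\
  forall a, 'D_a (fun y => 'D_(w y) f y) z
    = 'D_('D_a w z) f z + 'D_a (fun y => 'D_(w z) f y) z.
Proof.
move=> [n [e [c [lc ec]]]] fz df dw.
have dcw k : differentiable (c k \o w) z.
  by apply: differentiable_comp => //; case: (lc k).
pose g k y := c k (w y) *: 'D_(e k) f y.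
have dg k : differentiable (g k) z.
  exact: (@differentiable_scale _ _ _ (c k \o w) _ z (dcw k) (df (e k))).
have wE : \near z, (fun y => \sum_k g k y) z = (fun y => 'D_(w y) f y) z.
  by apply: filterS fz => y fy; rewrite (derive_in_basis _ ec fy).
have [ds _] := derive_sumE 0 dg.
split=> [|a]; first exact: near_differentiable wE ds.
rewrite -(near_eq_derive _ wE) (derive_sumE a dg).2.
have -> : 'D_a (fun y => 'D_(w z) f y) z
    = \sum_k c k (w z) *: 'D_a (fun y => 'D_(e k) f y) z.
  have dk k : differentiable (fun y => c k (w z) *: 'D_(e k) f y) z.
    by apply: differentiable_comp.
  rewrite -(near_eq_derive (f := fun y => \sum_k c k (w z) *: 'D_(e k) f y)).
    rewrite (derive_sumE a dk).2; apply: eq_bigr => k _.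
    by rewrite (derive_linmap a (@linmap_scale _ _ (c k (w z))) (df (e k))).
  by apply: filterS fz => y fy; rewrite (derive_in_basis _ ec fy).
rewrite (derive_in_basis _ ec (nbhs_singleton fz)) -big_split /=.
apply: eq_bigr => k _.
rewrite (@derive_scale _ _ _ (c k \o w) _ z a (dcw k) (df (e k))) /=.
by rewrite (derive_linmap a (lc k) dw).
Qed.

(** The vector-valued case follows by applying the coordinate functionals of the
    target. *)
Lemma schwarz E F (f : E -> F) z a b : fin_dim F ->
  (\forall y \near z, differentiable f y) ->
  differentiable (fun y => 'D_a f y) z ->
  differentiable (fun y => 'D_b f y) z ->
  'D_b (fun y => 'D_a f y) z = 'D_a (fun y => 'D_b f y) z.
Proof.
move=> [n [e [c [lc ec]]]] fz da db.
rewrite (ec ('D_b _ z)) (ec ('D_a _ z)); apply: eq_bigr => k _; congr (_ *: _).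
rewrite -(derive_linmap b (lc k) da) -(derive_linmap a (lc k) db).
have aE u : \near z, 'D_u (c k \o f) z = (c k \o (fun y => 'D_u f y)) z.
  by apply: filterS fz => y fy; rewrite derive_linmap.
rewrite -(near_eq_derive b (aE a)) -(near_eq_derive a (aE b)).
have dck u : differentiable (fun y => 'D_u f y) z ->
    differentiable (fun y => 'D_u (c k \o f) y : R^o) z.
  move=> du; apply: (@near_differentiable _ _ _ (c k \o (fun y => 'D_u f y))).
    by apply: filterS (aE u).
  by apply: differentiable_comp => //; case: (lc k).
apply: schwarz_real; [|exact: dck|exact: dck].
by apply: filterS fz => y fy; apply: differentiable_comp => //; case: (lc k).
Qed.

End Coordinates.

(** * Maps of class C^k *)

Section Smooth.
Context (R : realType).
Implicit Types E F G : normedModType R.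

(** The recursion is on the order of differentiation, for all maps at once: the
    rules for products and compositions mix derivatives of both factors. *)
Fixpoint Ck m E F (W : set E) (f : E -> F) : Prop :=
  (forall x, W x -> differentiable f x) /\
  if m is m'.+1 then forall v, Ck m' W (fun x => 'D_v f x) else True.

Lemma smooth_onP E F (W : set E) (f : E -> F) :
  smooth_on W f <-> forall m, Ck m W f.
Proof.
split=> [sf m|cf s x Wx].
  elim: m f sf => [|m IH] f sf; split=> //; first exact: (sf [::]).
    exact: (sf [::]).
  move=> v; apply: IH => s x Wx.
  by have := sf (rcons s v) x Wx; rewrite /iter_derive foldr_rcons.
have := cf (size s); elim/last_ind: s f {cf} => [|s v IH] f; first by case=> + _; apply.
rewrite size_rcons => -[_ /(_ v)/IH].
by rewrite /iter_derive foldr_rcons.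
Qed.

Lemma Ck_diff m E F (W : set E) (f : E -> F) x :
  Ck m W f -> W x -> differentiable f x.
Proof. by case: m => [|m] [+ _]; apply. Qed.

Lemma CkW m E F (W : set E) (f : E -> F) : Ck m.+1 W f -> Ck m W f.
Proof.
elim: m f => [|m IH] f [df Cf]; split=> // v.
exact: IH.
Qed.

Section Open.
Context E (W : set E) (oW : open W).

Lemma Ck_eq m F (f g : E -> F) :
  (forall x, W x -> f x = g x) -> Ck m W f -> Ck m W g.
Proof.
elim: m f g => [|m IH] f g fg [df Cf]; split=> //.
- by move=> x Wx; apply: near_differentiable (df x Wx); exact: open_near Wx fg.
- by move=> x Wx; apply: near_differentiable (df x Wx); exact: open_near Wx fg.
- move=> v; apply: IH (Cf v) => x Wx.
  by apply: near_eq_derive; exact: open_near Wx fg.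
Qed.

Lemma Ck_cst m F (a : F) : Ck m W (cst a).
Proof.
elim: m a => [|m IH] a; split=> // v.
by apply: Ck_eq (IH 0) => x Wx; rewrite derive_cst.
Qed.

Lemma Ck_linmap m F (l : E -> F) : linmap l -> Ck m W l.
Proof.
move=> [dl el]; case: m => [|m]; split=> // v.
by apply: Ck_eq (Ck_cst m (l v)) => x Wx; rewrite el.
Qed.

Lemma Ck_linmap_comp m F G (f : E -> F) (l : F -> G) :
  linmap l -> Ck m W f -> Ck m W (l \o f).
Proof.
move=> ll; elim: m f => [|m IH] f [df Cf]; split=> //.
- by move=> x Wx; apply: differentiable_comp; [exact: df|case: ll].
- by move=> x Wx; apply: differentiable_comp; [exact: df|case: ll].
- move=> v; apply: Ck_eq (IH _ (Cf v)) => x Wx.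
  by rewrite derive_linmap //; exact: df.
Qed.

Lemma CkD m F (f g : E -> F) :
  Ck m W f -> Ck m W g -> Ck m W (fun x => f x + g x).
Proof.
elim: m f g => [|m IH] f g [df Cf] [dg Cg]; split=> //.
- by move=> x Wx; apply: differentiableD; [exact: df|exact: dg].
- by move=> x Wx; apply: differentiableD; [exact: df|exact: dg].
- move=> v; apply: Ck_eq (IH _ _ (Cf v) (Cg v)) => x Wx.
  by rewrite deriveD //; apply: diff_derivable; [exact: df|exact: dg].
Qed.

Lemma Ck_sum m F n (f : 'I_n -> E -> F) :
  (forall k, Ck m W (f k)) -> Ck m W (fun x => \sum_k f k x).
Proof.
elim: n f => [|n IH] f Cf.
  by apply: Ck_eq (Ck_cst m 0) => x Wx; rewrite big_ord0.
apply: Ck_eq (CkD (Cf ord0) (IH (fun k => f (lift ord0 k)) (fun k => Cf _))).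
by move=> x Wx; rewrite big_ord_recl.
Qed.

Lemma Ck_scale m F (a : E -> R^o) (f : E -> F) :
  Ck m W a -> Ck m W f -> Ck m W (fun x => a x *: f x).
Proof.
elim: m a f => [|m IH] a f Ca Cf.
  by split=> // x Wx; apply: differentiable_scale; [apply: Ck_diff Ca Wx|apply: Ck_diff Cf Wx].
have [da Ca'] := Ca; have [df Cf'] := Cf; split.
  by move=> x Wx; apply: differentiable_scale; [exact: da|exact: df].
move=> v; apply: Ck_eq (CkD (IH _ _ (Ca' v) (CkW Cf)) (IH _ _ (CkW Ca) (Cf' v))).
by move=> x Wx; rewrite derive_scale //; [exact: da|exact: df].
Qed.

Lemma Ck_pair m F G (f : E -> F) (g : E -> G) :
  Ck m W f -> Ck m W g -> Ck m W (fun x => (f x, g x)).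
Proof.
elim: m f g => [|m IH] f g [df Cf] [dg Cg]; split=> //.
- by move=> x Wx; apply: differentiable_pair; [exact: df|exact: dg].
- by move=> x Wx; apply: differentiable_pair; [exact: df|exact: dg].
- move=> v; apply: Ck_eq (IH _ _ (Cf v) (Cg v)) => x Wx.
  by rewrite derive_pair //; [exact: df|exact: dg].
Qed.

(** By the chain rule D_v (g o f) is a finite sum of products of the coordinates
    of D_v f with (D_e g) o f, to which the induction hypothesis applies. *)
Lemma Ck_comp m F G (U : set F) (f : E -> F) (g : F -> G) : fin_dim F ->
  (forall x, W x -> U (f x)) -> Ck m W f -> Ck m U g -> Ck m W (g \o f).
Proof.
move=> [n [e [c [lc ec]]]] fU; elim: m f fU g => [|m IH] f fU g Cf Cg.
  split=> // x Wx; apply: differentiable_comp; first exact: Ck_diff Cf Wx.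
  by apply: Ck_diff Cg _; exact: fU.
have [df Cf'] := Cf; have [dg Cg'] := Cg; split.
  move=> x Wx; apply: differentiable_comp; first exact: df.
  by apply: dg; exact: fU.
move=> v; apply: (@Ck_eq _ _
  (fun x => \sum_k c k ('D_v f x) *: ((fun y => 'D_(e k) g y) \o f) x)).
  move=> x Wx; rewrite derive_comp //; [|exact: df|by apply: dg; exact: fU].
  by rewrite (derive_in_basis _ ec) //; apply: dg; exact: fU.
apply: Ck_sum => k; apply: Ck_scale.
  exact: Ck_linmap_comp (lc k) (Cf' v).
exact: (IH f fU _ (CkW Cf) (Cg' (e k))).
Qed.

End Open.
End Smooth.

(** * Smooth maps *)

Section SmoothOn.
Context (R : realType).
Implicit Types E F G : normedModType R.

Lemma smooth_on_diff E F (W : set E) (f : E -> F) x :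
  smooth_on W f -> W x -> differentiable f x.
Proof. by move=> sf; exact: (sf [::]). Qed.

Lemma smooth_on_derive E F (W : set E) (f : E -> F) v :
  smooth_on W f -> smooth_on W (fun x => 'D_v f x).
Proof.
move=> /smooth_onP sf; apply/smooth_onP => m.
by have [_] := sf m.+1; exact.
Qed.

Lemma smooth_on_sub E F (W U : set E) (f : E -> F) :
  W `<=` U -> smooth_on U f -> smooth_on W f.
Proof. by move=> WU sf s x /WU; exact: sf. Qed.

Section Open.
Context E (W : set E) (oW : open W).

Lemma smooth_on_eq F (f g : E -> F) :
  (forall x, W x -> f x = g x) -> smooth_on W f -> smooth_on W g.
Proof. by move=> fg /smooth_onP sf; apply/smooth_onP => m; exact: Ck_eq fg _. Qed.

Lemma smooth_on_linmap F (l : E -> F) : linmap l -> smooth_on W l.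
Proof. by move=> ll; apply/smooth_onP => m; exact: Ck_linmap. Qed.

Lemma smooth_on_cst F (a : F) : smooth_on W (cst a).
Proof. by apply/smooth_onP => m; exact: Ck_cst. Qed.

Lemma smooth_on_linmap_comp F G (f : E -> F) (l : F -> G) :
  linmap l -> smooth_on W f -> smooth_on W (l \o f).
Proof.
by move=> ll /smooth_onP sf; apply/smooth_onP => m; exact: Ck_linmap_comp.
Qed.

Lemma smooth_onD F (f g : E -> F) :
  smooth_on W f -> smooth_on W g -> smooth_on W (fun x => f x + g x).
Proof.
by move=> /smooth_onP sf /smooth_onP sg; apply/smooth_onP => m; exact: CkD.
Qed.

Lemma smooth_onZ F k (f : E -> F) :
  smooth_on W f -> smooth_on W (fun x => k *: f x).
Proof. exact: (smooth_on_linmap_comp (@linmap_scale _ _ k)). Qed.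

Lemma smooth_onN F (f : E -> F) :
  smooth_on W f -> smooth_on W (fun x => - f x).
Proof.
move=> sf; apply: smooth_on_eq (smooth_onZ (-1) sf) => x _.
by rewrite scaleN1r.
Qed.

Lemma smooth_onB F (f g : E -> F) :
  smooth_on W f -> smooth_on W g -> smooth_on W (fun x => f x - g x).
Proof. by move=> sf sg; apply: smooth_onD => //; exact: smooth_onN. Qed.

Lemma smooth_on_scale F (a : E -> R^o) (f : E -> F) :
  smooth_on W a -> smooth_on W f -> smooth_on W (fun x => a x *: f x).
Proof.
by move=> /smooth_onP sf /smooth_onP sg; apply/smooth_onP => m; exact: Ck_scale.
Qed.

Lemma smooth_on_pair F G (f : E -> F) (g : E -> G) :
  smooth_on W f -> smooth_on W g -> smooth_on W (fun x => (f x, g x)).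
Proof.
by move=> /smooth_onP sf /smooth_onP sg; apply/smooth_onP => m; exact: Ck_pair.
Qed.

Lemma smooth_on_comp F G (U : set F) (f : E -> F) (g : F -> G) : fin_dim F ->
  (forall x, W x -> U (f x)) -> smooth_on W f -> smooth_on U g ->
  smooth_on W (g \o f).
Proof.
move=> fF fU /smooth_onP sf /smooth_onP sg.
by apply/smooth_onP => m; exact: Ck_comp fF fU _ _.
Qed.

(** The base point p may move too; this is what makes the differential of a
    transition map, and hence the tangent charts, smooth. *)
Lemma smooth_on_along F G (U : set F) (f : F -> G) (p w : E -> F) : fin_dim F ->
  (forall x, W x -> U (p x)) -> smooth_on U f -> smooth_on W p ->
  smooth_on W w -> smooth_on W (fun x => 'D_(w x) f (p x)).
Proof.
move=> fF pU sf sp sw; have [n [e [c [lc ec]]]] := fF.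
apply: (@smooth_on_eq _
  (fun x => \sum_k c k (w x) *: 'D_(e k) f (p x))).
  move=> x Wx; rewrite (derive_in_basis _ ec) //.
  by apply: smooth_on_diff sf _; exact: pU.
have sk k : smooth_on W (fun x => c k (w x) *: 'D_(e k) f (p x)).
  apply: smooth_on_scale; first exact: smooth_on_linmap_comp (lc k) sw.
  exact: (smooth_on_comp fF pU sp (smooth_on_derive (e k) sf)).
apply/smooth_onP => m; apply: Ck_sum => // k.
by move/smooth_onP: (sk k); apply.
Qed.

Lemma smooth_on_near F (f : E -> F) z : smooth_on W f -> W z ->
  \forall y \near z, differentiable f y.
Proof.
move=> sf Wz; apply: (@filterS _ _ _ W); last exact: open_nbhs_nbhs.
by move=> y Wy; exact: smooth_on_diff sf Wy.
Qed.

Lemma smooth_on_schwarz F (f : E -> F) z a b : fin_dim F ->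
  smooth_on W f -> W z ->
  'D_b (fun y => 'D_a f y) z = 'D_a (fun y => 'D_b f y) z.
Proof.
move=> fF sf Wz; apply: schwarz => //; first exact: smooth_on_near.
  exact: smooth_on_diff (smooth_on_derive a sf) Wz.
exact: smooth_on_diff (smooth_on_derive b sf) Wz.
Qed.

Lemma smooth_derive_along F (f : E -> F) (w : E -> E) z a : fin_dim E ->
  smooth_on W f -> W z -> differentiable w z ->
  'D_a (fun y => 'D_(w y) f y) z
    = 'D_('D_a w z) f z + 'D_a (fun y => 'D_(w z) f y) z.
Proof.
move=> fE sf Wz dw.
have [_] := derive_along fE (smooth_on_near sf Wz)
  (fun v => smooth_on_diff (smooth_on_derive v sf) Wz) dw.
exact.
Qed.

Lemma smooth_diff_along F (f : E -> F) (w : E -> E) z : fin_dim E ->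
  smooth_on W f -> W z -> differentiable w z ->
  differentiable (fun y => 'D_(w y) f y) z.
Proof.
move=> fE sf Wz dw.
by have [] := derive_along fE (smooth_on_near sf Wz)
  (fun v => smooth_on_diff (smooth_on_derive v sf) Wz) dw.
Qed.

Lemma second_derive_in_basis F n (e : 'I_n -> E) (c : 'I_n -> E -> R^o)
    (f : E -> F) a b z :
  (forall v, v = \sum_k c k v *: e k) -> smooth_on W f -> W z ->
  'D_b (fun x => 'D_a f x) z = \sum_k c k a *: 'D_b (fun x => 'D_(e k) f x) z.
Proof.
move=> ec sf Wz.
have dk k : differentiable (fun x => c k a *: 'D_(e k) f x) z.
  exact: (smooth_on_diff (smooth_onZ (c k a) (smooth_on_derive (e k) sf)) Wz).
rewrite (@near_eq_derive _ _ _ _ (fun x => \sum_k c k a *: 'D_(e k) f x)).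
  rewrite (derive_sumE b dk).2; apply: eq_bigr => k _.
  apply: (derive_linmap b (@linmap_scale _ _ (c k a))).
  exact: smooth_on_diff (smooth_on_derive (e k) sf) Wz.
apply: (open_near oW Wz) => x Wx; rewrite (derive_in_basis a ec) //.
exact: smooth_on_diff sf Wx.
Qed.

(** Linearity in the inner direction is linearity of a differential once the two
    derivatives are exchanged. *)
Lemma smooth_second_linmap F (f : E -> F) b z : fin_dim F ->
  smooth_on W f -> W z -> linmap (fun a => 'D_b (fun x => 'D_a f x) z).
Proof.
move=> fF sf Wz.
have -> : (fun a => 'D_b (fun x => 'D_a f x) z)
    = (fun a => 'D_a (fun x => 'D_b f x) z).
  by apply/funext => a; exact: smooth_on_schwarz.
by apply: linmap_derive; exact: smooth_on_diff (smooth_on_derive b sf) Wz.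
Qed.

Lemma smooth_on_along2 F (f : E -> F) (w1 w2 : E -> E) : fin_dim E ->
  smooth_on W f -> smooth_on W w1 -> smooth_on W w2 ->
  smooth_on W (fun y => 'D_(w2 y) (fun x => 'D_(w1 y) f x) y).
Proof.
move=> fE sf s1 s2; have [n [e [c [lc ec]]]] := fE.
apply: (@smooth_on_eq _
  (fun y => \sum_k c k (w1 y) *: 'D_(w2 y) (fun x => 'D_(e k) f x) y)).
  by move=> y Wy; rewrite (second_derive_in_basis _ _ ec sf Wy).
have sk k : smooth_on W (fun y => c k (w1 y) *: 'D_(w2 y) (fun x => 'D_(e k) f x) y).
  apply: smooth_on_scale; first exact: smooth_on_linmap_comp (lc k) s1.
  apply: (@smooth_on_along _ _ W _ id w2 fE (fun x h => h) (smooth_on_derive (e k) sf) _ s2).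
  exact: smooth_on_linmap (@linmap_id _ _).
apply/smooth_onP => m; apply: Ck_sum => // k.
by move/smooth_onP: (sk k); apply.
Qed.

(** Leibniz' rule for the trilinear pairing of the second differential of f with
    two vector fields. *)
Lemma smooth_derive_along2 F (f : E -> F) (w1 w2 : E -> E) z v : fin_dim E ->
  smooth_on W f -> smooth_on W w1 -> smooth_on W w2 -> W z ->
  'D_v (fun y => 'D_(w2 y) (fun x => 'D_(w1 y) f x) y) z
    = 'D_v (fun y => 'D_(w2 z) (fun x => 'D_(w1 z) f x) y) z
      + 'D_(w2 z) (fun x => 'D_('D_v w1 z) f x) z
      + 'D_('D_v w2 z) (fun x => 'D_(w1 z) f x) z.
Proof.
move=> fE sf s1 s2 Wz; have [n [e [c [lc ec]]]] := fE.
have dw1 := smooth_on_diff s1 Wz; have dw2 := smooth_on_diff s2 Wz.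
pose fk k x := 'D_(e k) f x.
have sfk k : smooth_on W (fk k) by exact: smooth_on_derive.
have dck k : differentiable (c k \o w1) z.
  by apply: differentiable_comp => //; case: (lc k).
pose g k y := c k (w1 y) *: 'D_(w2 y) (fk k) y.
have da k : differentiable (fun y => 'D_(w2 y) (fk k) y) z.
  exact: smooth_diff_along.
have dg k : differentiable (g k) z.
  exact: (@differentiable_scale _ _ _ (c k \o w1) _ z (dck k) (da k)).
rewrite (@near_eq_derive _ _ _ _ (fun y => \sum_k g k y)); last first.
  by apply: (open_near oW Wz) => y Wy; rewrite (second_derive_in_basis _ _ ec sf Wy).
rewrite (derive_sumE v dg).2.
have -> : 'D_v (fun y => 'D_(w2 z) (fun x => 'D_(w1 z) f x) y) z
   = \sum_k c k (w1 z) *: 'D_v (fun y => 'D_(w2 z) (fk k) y) z.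
  have dk k : differentiable (fun y => c k (w1 z) *: 'D_(w2 z) (fk k) y) z.
    exact: (smooth_on_diff (smooth_onZ (c k (w1 z)) (smooth_on_derive (w2 z) (sfk k))) Wz).
  rewrite (@near_eq_derive _ _ _ _ (fun y => \sum_k c k (w1 z) *: 'D_(w2 z) (fk k) y)).
    rewrite (derive_sumE v dk).2; apply: eq_bigr => k _.
    apply: (derive_linmap v (@linmap_scale _ _ (c k (w1 z)))).
    exact: smooth_on_diff (smooth_on_derive (w2 z) (sfk k)) Wz.
  by apply: (open_near oW Wz) => y Wy; rewrite (second_derive_in_basis _ _ ec sf Wy).
rewrite (second_derive_in_basis ('D_v w1 z) _ ec sf Wz).
rewrite (second_derive_in_basis (w1 z) _ ec sf Wz).
rewrite -!big_split /=; apply: eq_bigr => k _.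
rewrite (@derive_scale _ _ _ (c k \o w1) _ z v (dck k) (da k)) /=.
rewrite (derive_linmap v (lc k) dw1) (smooth_derive_along v fE (sfk k) Wz dw2).
have perm (p q r : F) : p + (q + r) = r + p + q.
  by rewrite [q + r]addrC addrA [p + r]addrC.
by rewrite scalerDr; exact: perm.
Qed.

End Open.
End SmoothOn.

(** * Tangent vectors and Lie brackets in a chart *)

Section AtlasTheory.
Context (R : realType) (X : Type) (E : normedModType R) (A : atlas X E).
Implicit Types (F : normedModType R) (i j : chart_index A) (p : X) (U W : set X).

(** The part of a manifold structure on which the calculus depends, expressed in
    coordinates only, so that it passes to the tangent bundle. *)
Record smooth_atlas : Prop := {
  atlas_chart_at : forall p, source A (chart_at A p) p;
  atlas_chartK : forall i p, source A i p -> inv_chart A i (chart A i p) = p;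
  atlas_open_overlap : forall i j,
    open (chart A i @` (source A i `&` source A j));
  atlas_transition : forall i j,
    smooth_on (chart A i @` (source A i `&` source A j))
      (chart A j \o inv_chart A i) }.

Arguments atlas_transition _ i j : clear implicits.

Hypotheses (finE : fin_dim E) (SA : smooth_atlas).

Let at_src p : source A (chart_at A p) p := atlas_chart_at SA p.
Let chK i p : source A i p -> inv_chart A i (chart A i p) = p :=
  @atlas_chartK SA i p.
Hint Resolve at_src : core.

Definition transition i j : E -> E := chart A j \o inv_chart A i.
Definition chart_image i W : set E := chart A i @` (source A i `&` W).

Lemma mem_chart_image i W p : source A i p -> W p -> chart_image i W (chart A i p).
Proof. by move=> ip Wp; exists p. Qed.

Lemma open_overlap i j : open (chart_image i (source A j)).
Proof. exact: atlas_open_overlap. Qed.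

Lemma transitionE i j p : source A i p ->
  transition i j (chart A i p) = chart A j p.
Proof. by move=> ip; rewrite /transition /= chK. Qed.

Lemma transition_diff i j p : source A i p -> source A j p ->
  differentiable (transition i j) (chart A i p).
Proof.
move=> ip jp; apply: (smooth_on_diff (atlas_transition SA i j)).
exact: mem_chart_image.
Qed.

Lemma chart_change_near F (f : X -> F) i j p : source A i p -> source A j p ->
  \forall z \near chart A i p, ((f \o inv_chart A j) \o transition i j) z
     = (f \o inv_chart A i) z.
Proof.
move=> ip jp; apply: (open_near (open_overlap i j)); first exact: mem_chart_image.
by move=> _ [q [iq jq] <-]; rewrite /= !chK.
Qed.

Lemma chart_change_derive F (f : X -> F) i j p v :
  source A i p -> source A j p ->
  differentiable (f \o inv_chart A j) (chart A j p) ->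
  'D_v (f \o inv_chart A i) (chart A i p)
    = 'D_('D_v (transition i j) (chart A i p)) (f \o inv_chart A j)
        (chart A j p).
Proof.
move=> ip jp df; rewrite -(near_eq_derive v (chart_change_near f ip jp)).
rewrite derive_comp ?transitionE //; exact: transition_diff.
Qed.

(** Cocycle rule for the differentials of the transition maps. *)
Lemma derive_transition i j k p v :
  source A i p -> source A j p -> source A k p ->
  'D_('D_v (transition i j) (chart A i p)) (transition j k) (chart A j p)
    = 'D_v (transition i k) (chart A i p).
Proof.
move=> ip jp kp; rewrite -(chart_change_derive (f := chart A k)) //.
exact: transition_diff.
Qed.

Lemma derive_transition_id i p v : source A i p ->
  'D_v (transition i i) (chart A i p) = v.
Proof.
move=> ip; rewrite (@near_eq_derive _ _ _ _ id) ?derive_id //.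
apply: (open_near (open_overlap i i)); first exact: mem_chart_image.
by move=> _ [q [iq jq] <-]; rewrite transitionE.
Qed.

Lemma derive_components i j p v : source A i p -> source A j p ->
  'D_(components i p v) (transition i j) (chart A i p) = components j p v.
Proof. by move=> ip jp; exact: derive_transition. Qed.

Lemma components_at p v : components (chart_at A p) p v = v.
Proof. exact: derive_transition_id. Qed.

(** The inverse of components; fields with prescribed components in a chart are
    built from it. *)
Definition vector_of_components i p (w : E) : E :=
  'D_w (transition i (chart_at A p)) (chart A i p).

Lemma vector_of_componentsK i p : source A i p ->
  cancel (vector_of_components i p) (components i p).
Proof.
by move=> ip w; rewrite /components derive_transition // derive_transition_id.
Qed.

Lemma componentsK i p : source A i p ->
  cancel (components i p) (vector_of_components i p).
Proof.
by move=> ip v; rewrite /vector_of_components derive_components // components_at.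
Qed.

Lemma components_inj i p : source A i p -> injective (components i p).
Proof. by move=> ip; exact: can_inj (componentsK ip). Qed.

Lemma linmap_components i p : source A i p -> linmap (components i p).
Proof. by move=> ip; apply: linmap_derive; exact: transition_diff. Qed.

Definition local_field i (V : X -> E) : E -> E := fun z =>
  components i (inv_chart A i z) (V (inv_chart A i z)).

Lemma local_fieldE i V p : source A i p ->
  local_field i V (chart A i p) = components i p (V p).
Proof. by move=> ip; rewrite /local_field chK. Qed.

(** The definition of vderive uses the distinguished chart of each point, which
    varies with the point; a fixed chart is needed to differentiate again. *)
Lemma vderiveE i (V : X -> E) (f : X -> R) p : source A i p ->
  differentiable (f \o inv_chart A i : E -> R^o) (chart A i p) ->
  vderive A V f p = 'D_(components i p (V p)) (f \o inv_chart A i : E -> R^o)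
                      (chart A i p).
Proof.
by move=> ip df; rewrite /vderive (chart_change_derive _ (at_src p) ip df).
Qed.

Lemma atlas_open_setI W U :
  atlas_open A W -> atlas_open A U -> atlas_open A (W `&` U).
Proof.
move=> oW oU i; rewrite (_ : _ @` _ = chart_image i W `&` chart_image i U).
  by apply: openI; [exact: oW|exact: oU].
apply/seteqP; split=> [_ [p [ip [Wp Up]] <-]|_ [[p [ip Wp] <-]] [q [iq Uq] pq]].
  by split; exact: mem_chart_image.
by exists p => //; do 2?[split=> //]; rewrite -(chK ip) -pq chK.
Qed.

Lemma atlas_open_source j : atlas_open A (source A j).
Proof. by move=> i; exact: open_overlap. Qed.

Lemma smooth_fun_coord i F (l : E -> F) : linmap l ->
  smooth_fun A (source A i) (l \o chart A i).
Proof.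
move=> ll j.
exact: (smooth_on_linmap_comp (open_overlap j i) ll (atlas_transition SA j i)).
Qed.

Lemma smooth_fun_diff F W (f : X -> F) i p : smooth_fun A W f ->
  source A i p -> W p -> differentiable (f \o inv_chart A i) (chart A i p).
Proof. by move=> sf ip Wp; apply: smooth_on_diff (sf i) _; exact: mem_chart_image. Qed.

(** Smoothness in one chart covering the domain suffices, since the components in
    any other chart are obtained by applying the differential of a transition
    map. *)
Lemma smooth_vfield_local i W V : W `<=` source A i -> atlas_open A W ->
  smooth_on (chart_image i W) (local_field i V) -> smooth_vfield A W V.
Proof.
move=> Wi oW sV j.
have WjI z : chart_image j W z -> chart_image i W (transition j i z).
  by move=> [p [jp Wp] <-]; rewrite transitionE //; apply: mem_chart_image; [exact: Wi|].
have sT : smooth_on (chart_image j W) (transition j i).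
  apply: smooth_on_sub (atlas_transition SA j i) => _ [p [jp Wp] <-].
  by apply: mem_chart_image => //; exact: Wi.
have jC z : chart_image j W z -> inv_chart A i (transition j i z) = inv_chart A j z.
  by move=> [p [jp Wp] <-]; rewrite transitionE // !chK //; exact: Wi.
have sR : smooth_on (chart_image j W)
    (fun z => 'D_(local_field i V (transition j i z)) (transition i j) (transition j i z)).
  apply: (@smooth_on_along _ _ _ (oW j) _ _ (chart_image i (source A j))
    (transition i j) (transition j i) (local_field i V \o transition j i) finE).
  - by move=> _ [p [jp Wp] <-]; rewrite transitionE //; apply: mem_chart_image => //; exact: Wi.
  - exact: atlas_transition.
  - exact: sT.
  - exact: (smooth_on_comp (oW j) finE WjI sT sV).
apply: (smooth_on_eq (oW j) _ sR) => _ [p [jp Wp] <-].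
have ip := Wi _ Wp.
by rewrite transitionE // local_fieldE // derive_components // chK.
Qed.
Lemma derive_local_field_near i (V : X -> E) (f : X -> R) U p : atlas_open A U ->
  source A i p -> U p -> smooth_fun A U (f : X -> R^o) ->
  \forall z \near chart A i p,
    'D_(local_field i V z) (f \o inv_chart A i : E -> R^o) z
      = (vderive A V f \o inv_chart A i) z.
Proof.
move=> oU ip Up sf; apply: (open_near (oU i)); first exact: mem_chart_image.
move=> _ [q [iq Uq] <-] /=; rewrite chK // (@vderiveE i) ?local_fieldE //.
exact: smooth_fun_diff sf iq Uq.
Qed.

Lemma vderive_vderive i (V W : X -> E) (f : X -> R) U p : atlas_open A U ->
  source A i p -> U p -> smooth_fun A U (f : X -> R^o) ->
  differentiable (local_field i W) (chart A i p) ->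
  vderive A V (vderive A W f) p =
    'D_('D_(components i p (V p)) (local_field i W) (chart A i p))
       (f \o inv_chart A i : E -> R^o) (chart A i p)
    + 'D_(components i p (V p)) (fun z => 'D_(components i p (W p))
         (f \o inv_chart A i : E -> R^o) z : R^o) (chart A i p).
Proof.
move=> oU ip Up sf dW; have sfi := sf i; have oUi := oU i.
have Uz : chart_image i U (chart A i p) by exact: mem_chart_image.
have nf := derive_local_field_near W oU ip Up sf.
rewrite (@vderiveE i) //; last first.
  exact: near_differentiable nf (smooth_diff_along oUi finE sfi Uz dW).
have := smooth_derive_along oUi (components i p (V p)) finE sfi Uz dW.
move=> Hd; rewrite -(local_fieldE W ip).
by apply: etrans Hd; apply/esym; exact: near_eq_derive nf.
Qed.

(** The bracket is specified by its action on local smooth functions. The vector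
    with the classical components acts that way by the symmetry of second
    derivatives, and it is the only one because the coordinates of the chart are
    themselves local smooth functions. Only differentiability of the two fields
    at p enters, so brackets of fields such as K X can be treated point by
    point. *)
Lemma lie_bracketE i (V W : X -> E) p : source A i p ->
  differentiable (local_field i V) (chart A i p) ->
  differentiable (local_field i W) (chart A i p) ->
  components i p (lie_bracket A V W p)
    = 'D_(components i p (V p)) (local_field i W) (chart A i p)
      - 'D_(components i p (W p)) (local_field i V) (chart A i p).
Proof.
move=> ip dV dW; set w0 := RHS.
set P := [set w | forall (U : set X) (f : X -> R),
    atlas_open A U -> U p -> smooth_fun A U (f : X -> R^o) ->
    vderive A (fun=> w) f p
      = vderive A V (vderive A W f) p - vderive A W (vderive A V f) p].
have Pw : P (vector_of_components i p w0).
  move=> U f oU Up sf; have Uz : chart_image i U (chart A i p) by exact: mem_chart_image.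
  have dfi := smooth_fun_diff sf ip Up.
  rewrite (@vderiveE i) // vector_of_componentsK //.
  rewrite !(@vderive_vderive i _ _ _ U) //.
  have S := smooth_on_schwarz (oU i) (components i p (W p)) (components i p (V p))
    (@fin_dim_scalar R) (sf i) Uz.
  have cancel (x y s t : R^o) : s = t -> x - y = x + s - (y + t).
    by move=> ->; rewrite opprD addrACA subrr addr0.
  exact: etrans (derive_linB _ _ dfi) (cancel _ _ _ _ S).
have Pl : P (lie_bracket A V W p) by apply: xgetPex; exists (vector_of_components i p w0).
have [n [e [c [lc ec]]]] := finE.
have cE w k : c k (components i p w) = vderive A (fun=> w) (c k \o chart A i) p.
  have dt : differentiable (transition i i) (chart A i p) by exact: transition_diff.
  have [dc _] := lc k.
  rewrite (@vderiveE i) //; last by apply: (differentiable_comp dt).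
  by rewrite (derive_linmap _ (lc k) dt) derive_transition_id.
rewrite -(vector_of_componentsK ip w0) [LHS]ec [RHS]ec; apply: eq_bigr => k _.
congr (_ *: _); rewrite !cE.
have sk := @smooth_fun_coord i _ _ (lc k).
by rewrite (Pl _ _ (@atlas_open_source i) ip sk) (Pw _ _ (@atlas_open_source i) ip sk).
Qed.
End AtlasTheory.

Arguments atlas_transition {R X E A} _ i j.

(** * The tangent bundle as a manifold *)

Section TangentAtlas.
Context (R : realType) (X : Type) (E : normedModType R) (A : atlas X E).
Hypotheses (finE : fin_dim E) (SA : smooth_atlas A).

Local Notation TA := (tangent_atlas A).
Implicit Types (i j : chart_index A) (u : X * E) (v w : E) (xi : E * E).

Let at_src p : source A (chart_at A p) p := atlas_chart_at SA p.
Let chK i p : source A i p -> inv_chart A i (chart A i p) = p :=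
  @atlas_chartK _ _ _ _ SA i p.
Hint Resolve at_src : core.

Lemma tangent_overlapE i j :
  chart TA i @` (source TA i `&` source TA j)
    = fst @^-1` (chart A i @` (source A i `&` source A j)).
Proof.
apply/seteqP; split=> [_ [[p v] [ip jp] <-]|[x y] [p [ip jp] /= px]].
  by exists p.
exists (p, vector_of_components i p y) => //=.
by rewrite vector_of_componentsK // px.
Qed.

Lemma open_fst_preimage (O : set E) : open O -> open (fst @^-1` O : set (E * E)).
Proof. by move=> oO; apply: open_comp => // x _; exact: cvg_fst. Qed.

(** The transition map of the tangent bundle: a transition map of the base paired
    with its differential. *)
Definition tangent_transition i j (z : E * E) : E * E :=
  (transition i j z.1, 'D_(z.2) (transition i j) z.1).

Lemma tangent_transitionE i j z :
  (chart TA i @` (source TA i `&` source TA j)) z ->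
  (chart TA j \o inv_chart TA i) z = tangent_transition i j z.
Proof.
rewrite tangent_overlapE; case: z => x y [p [ip jp] /= px].
rewrite /tangent_transition /= -px chK // transitionE //; congr (_, _).
exact: derive_transition.
Qed.

Lemma tangent_transition_smooth i j :
  smooth_on (fst @^-1` (chart A i @` (source A i `&` source A j)))
    (tangent_transition i j).
Proof.
have oO := open_fst_preimage (atlas_open_overlap SA i j).
have s1 := smooth_on_linmap oO (@linmap_fst R E E).
have s2 := smooth_on_linmap oO (@linmap_snd R E E).
have sT := atlas_transition SA i j.
apply: (smooth_on_pair oO).
  exact: (smooth_on_comp oO finE (fun z h => h) s1 sT).
exact: (smooth_on_along oO finE (fun z h => h) sT s1 s2).
Qed.

Lemma tangent_smooth_atlas : smooth_atlas TA.
Proof.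
split.
- by move=> u; exact: at_src.
- move=> i [p v] /= ip; rewrite chK //; congr (_, _).
  exact: (componentsK SA ip).
- by move=> i j; rewrite tangent_overlapE; apply/open_fst_preimage/atlas_open_overlap.
- move=> i j; have oO := open_fst_preimage (atlas_open_overlap SA i j).
  rewrite tangent_overlapE; apply: (smooth_on_eq oO _ (@tangent_transition_smooth i j)).
  by move=> z Oz; rewrite -tangent_transitionE // tangent_overlapE.
Qed.

Let ST := tangent_smooth_atlas.

Lemma tangent_components i u xi : source A i u.1 ->
  components (A := TA) i u xi
    = 'D_xi (tangent_transition (chart_at A u.1) i)
        (chart TA (chart_at TA u) u).
Proof.
move=> iu; apply: near_eq_derive.
apply: (open_near (atlas_open_overlap ST (chart_at TA u) i)).
  by exists u; first by split; [exact: at_src|exact: iu].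
by move=> z Oz; exact: tangent_transitionE.
Qed.

Lemma tangent_transition_diff i u : source A i u.1 ->
  differentiable (tangent_transition (chart_at A u.1) i)
    (chart TA (chart_at TA u) u).
Proof.
move=> iu; apply: (smooth_on_diff (@tangent_transition_smooth _ _)) => /=.
by exists u.1; first by split; [exact: at_src|exact: iu].
Qed.

Lemma tangent_components1 i u xi : source A i u.1 ->
  (components (A := TA) i u xi).1 = components i u.1 xi.1.
Proof.
move=> iu; rewrite tangent_components //.
rewrite -(derive_linmap _ (@linmap_fst R E E) (tangent_transition_diff iu)).
have l1 := @linmap_fst R E E; have [d1 e1] := l1.
have -> : fst \o tangent_transition (chart_at A u.1) i
  = transition (chart_at A u.1) i \o fst by [].
rewrite derive_comp // ?e1 //=.
exact: transition_diff.
Qed.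

(** Along a vertical vector the base point is frozen and the tangent transition
    map is the linear map components i u.1. *)
Lemma tangent_components_vertical i u w : source A i u.1 ->
  components (A := TA) i u (0, w) = (0, components i u.1 w).
Proof.
move=> iu; rewrite [LHS]surjective_pairing tangent_components1 //=.
have lc := linmap_components SA iu.
have [dc _] := lc.
congr (_, _); first exact: linmap_0 lc.
rewrite tangent_components //.
rewrite -(derive_linmap _ (@linmap_snd R E E) (tangent_transition_diff iu)).
rewrite derive_line /=.
have -> : (fun h : R => 'D_(h *: w + components (chart_at A u.1) u.1 u.2)
   (transition (chart_at A u.1) i)
   (h *: 0 + chart A (chart_at A u.1) u.1))
  = components i u.1 \o (fun h : R => h *: w + u.2).
  by apply/funext => h /=; rewrite scaler0 add0r components_at.
have dl : is_diff (0 : R) (fun h : R => h *: w + u.2) ( *:%R^~ w).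
  by apply: is_diff_eq; apply/funext => h /=; rewrite !fctE /= addr0.
rewrite (derive_linmap _ lc); last exact: ex_diff.
by congr components; rewrite deriveE ?diff_val ?scale1r //; exact: ex_diff.
Qed.

End TangentAtlas.

Section Lifts.
Context (R : realType) (n : nat) (M : topologicalType) (A : atlas M 'rV[R]_n).
Hypothesis (SA : smooth_atlas A).
Local Notation V := 'rV[R]_n.
Local Notation TA := (tangent_atlas A).

Lemma smooth_manifold_atlas : smooth_manifold A -> smooth_atlas A.
Proof.
move=> HM; split; [exact: mfd_chart_at|exact: mfd_chartK| |exact: mfd_transition].
move=> i j; rewrite (_ : _ @` _ = (chart A i @` source A i) `&`
   [set z | (inv_chart A i @^-1` source A j) z]).
  rewrite openE => z [zi zj]; rewrite /interior.
  apply: filterI; first by apply: open_nbhs_nbhs; split=> //; exact: mfd_open_target.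
  apply: (@mfd_inv_chart_cont _ _ _ _ HM i z); first by rewrite inE.
  by apply: open_nbhs_nbhs; split=> //; exact: mfd_open_source.
apply/seteqP; split=> [_ [p [ip jp] <-]|_ [[p ip <-]]] /=.
  by split; [exists p|rewrite (mfd_chartK HM)].
by rewrite (mfd_chartK HM) // => jp; exists p.
Qed.

(** The tangent space of the bundle at u is identified with its model by the
    chart induced by the distinguished one of u.1, in which lifts have their
    naive expression. *)
Lemma vliftE u w : vlift A u w = (0, w).
Proof.
rewrite /vlift derive1E.
have -> : (fun t : R => chart TA (chart_at TA u) (u.1, u.2 + t *: w))
  = (fun t => (chart A (chart_at A u.1) u.1, u.2 + t *: w)).
  by apply/funext => t /=; rewrite (components_at SA).
have dl : is_diff (0 : R) (fun t : R => u.2 + t *: w) ( *:%R^~ w).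
  by apply: is_diff_eq; apply/funext => h /=; rewrite !fctE /= add0r.
have dd : differentiable (fun t : R => u.2 + t *: w) 0 by exact: ex_diff.
rewrite (derive_pair _ (differentiable_cst _ _) dd) derive_cst; congr (_, _).
by rewrite deriveE // diff_val scale1r.
Qed.

Lemma rhoE u xi : rho A u xi = xi.1.
Proof.
have iu := atlas_chart_at SA u.1.
have [d1 e1] := @linmap_fst R V V.
pose c := chart_at A u.1; pose z := chart TA (chart_at TA u) u.
have dt : differentiable (transition c c) z.1 := transition_diff SA iu iu.
apply: (etrans (derive_comp xi (d1 z) dt)).
apply: (etrans (congr1 (fun w => 'D_w (transition c c) z.1) (e1 z xi))).
exact: (derive_transition_id SA xi.1 iu).
Qed.

End Lifts.

(** * Fields on the tangent bundle in a chart *)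

Section LocalFields.
Context (R : realType) (n : nat) (M : topologicalType) (A : atlas M 'rV[R]_n).
Hypothesis (SA : smooth_atlas A).
Local Notation V := 'rV[R]_n.
Local Notation TM := (M * 'rV[R]_n)%type.
Local Notation TTM := ('rV[R]_n * 'rV[R]_n)%type.
Local Notation TA := (tangent_atlas A).

Let finV : fin_dim V := fin_dim_rV R n.
Let finE : fin_dim TTM := fin_dim_prod finV finV.
Let ST : smooth_atlas TA := tangent_smooth_atlas finV SA.

Context (i : chart_index A) (W : set TM).
Hypotheses (oW : atlas_open TA W) (Wi : W `<=` source TA i).

Definition coord_image : set TTM := @chart_image _ _ _ TA i W.
Local Notation O := coord_image.

Definition local_vfield (X : TM -> TTM) : TTM -> TTM :=
  @local_field _ _ _ TA i X.
(** A section of the pulled back bundle is a vector-valued function of the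
    coordinates (x, y). *)
Definition local_pifield (Y : TM -> V) : TTM -> V := fun z =>
  let u := inv_chart TA i z in components (A := A) i u.1 (Y u).
Local Notation lf := local_vfield.
Local Notation lp := local_pifield.

Lemma open_coord_image : open O. Proof. exact: oW. Qed.
Let oO := open_coord_image.

Lemma coord_imageP z : O z -> exists2 u, W u & z = chart TA i u.
Proof. by move=> [u [_ Wu] <-]; exists u. Qed.

Lemma mem_coord_image u : W u -> O (chart TA i u).
Proof. by move=> Wu; exists u => //; split=> //; exact: Wi. Qed.

Lemma local_vfield_chart u X : W u -> lf X (chart TA i u) = components (A := TA) i u (X u).
Proof. by move=> /Wi iu; exact: (local_fieldE ST). Qed.

Lemma local_pifield_chart u Y : W u -> lp Y (chart TA i u) = components (A := A) i u.1 (Y u).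
Proof. by move=> /Wi iu; rewrite /lp (atlas_chartK ST). Qed.

Lemma local_gammaF Y z : O z -> lf (gammaF A Y) z = vert (lp Y z).
Proof.
move=> /coord_imageP[u Wu ->]; rewrite local_vfield_chart // local_pifield_chart // /gammaF vliftE //.
by apply: tangent_components_vertical => //; exact: Wi Wu.
Qed.

Lemma local_rhoF X z : O z -> lp (rhoF A X) z = (lf X z).1.
Proof.
move=> /coord_imageP[u Wu ->]; rewrite local_vfield_chart // local_pifield_chart // /rhoF rhoE //.
by rewrite tangent_components1 //; exact: Wi Wu.
Qed.

Lemma local_J X z : O z -> lf (J A X) z = vert (lf X z).1.
Proof. by move=> Oz; rewrite local_gammaF // local_rhoF. Qed.

Lemma local_eta z : O z -> lp (@Defs.eta R n M) z = z.2.
Proof. by move=> /coord_imageP[u Wu ->]; rewrite local_pifield_chart. Qed.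

Lemma local_liouville z : O z -> lf (liouville A) z = vert z.2.
Proof. by move=> Oz; rewrite local_gammaF // local_eta. Qed.

Lemma local_lie_bracket X Y z : O z -> differentiable (lf X) z -> differentiable (lf Y) z ->
  lf (lie_bracket TA X Y) z = 'D_(lf X z) (lf Y) z - 'D_(lf Y z) (lf X) z.
Proof.
move=> /coord_imageP[u Wu ->] dX dY.
rewrite (local_vfield_chart X Wu) (local_vfield_chart Y Wu) (local_vfield_chart (lie_bracket TA X Y) Wu).
exact: (lie_bracketE finE ST (Wi Wu) dX dY).
Qed.

Lemma local_vfield_diff X (f : TTM -> TTM) z : O z ->
  (forall y, O y -> lf X y = f y) -> differentiable f z ->
  differentiable (lf X) z.
Proof.
move=> Oz Xf; apply: near_differentiable.
by apply: (open_near oO Oz) => y Oy; rewrite Xf.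
Qed.

Lemma local_vfield_derive X (f : TTM -> TTM) z v : O z ->
  (forall y, O y -> lf X y = f y) -> 'D_v (lf X) z = 'D_v f z.
Proof. by move=> Oz Xf; apply: near_eq_derive; exact: open_near oO Oz Xf. Qed.

Lemma local_pifield_derive Y (f : TTM -> V) z v : O z ->
  (forall y, O y -> lp Y y = f y) -> 'D_v (lp Y) z = 'D_v f z.
Proof. by move=> Oz Xf; apply: near_eq_derive; exact: open_near oO Oz Xf. Qed.

Lemma smooth_local_pifield Y : smooth_pifield A W Y -> smooth_on O (lp Y).
Proof. by move=> sY; exact: sY i. Qed.

Lemma smooth_vfield_of_local X : smooth_on O (lf X) -> smooth_vfield TA W X.
Proof. exact: (smooth_vfield_local finE ST Wi oW). Qed.

(** The vertical lift reduces this to the case of vector fields. *)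
Lemma smooth_pifield_of_local Y : smooth_on O (lp Y) -> smooth_pifield A W Y.
Proof.
move=> sY.
have sg : smooth_on O (lf (gammaF A Y)).
  apply: (smooth_on_eq oO (f := fun z => vert (lp Y z))).
    by move=> z Oz /=; rewrite local_gammaF.
  exact: (smooth_on_linmap_comp oO (linmap_vert V) sY).
have {}sg := smooth_vfield_of_local sg.
move=> j; have oj : open (chart TA j @` (source TA j `&` W)) by exact: oW.
apply: (smooth_on_eq oj _
  (smooth_on_linmap_comp oj (@linmap_snd R V V) (sg j))).
move=> _ [u [ju Wu] <-].
have gE : local_field (A := TA) j (gammaF A Y) (chart TA j u)
    = (0, components (A := A) j u.1 (Y u)).
  rewrite (local_fieldE ST _ ju) /gammaF (vliftE SA).
  exact: (tangent_components_vertical finV SA (Y u) ju).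
transitivity (components (A := A) j u.1 (Y u)); first exact: (congr1 snd gE).
by rewrite (atlas_chartK ST ju).
Qed.

(** Coordinate fields of a chart, which serve as test fields. *)
Definition const_vfield (a : TTM) : TM -> TTM := fun u =>
  vector_of_components (A := TA) i u a.

Lemma local_const_vfield a z : O z -> lf (const_vfield a) z = a.
Proof.
move=> /coord_imageP[u Wu ->]; rewrite local_vfield_chart //.
by rewrite (vector_of_componentsK ST) //; exact: Wi Wu.
Qed.

Lemma smooth_const_vfield a : smooth_vfield TA W (const_vfield a).
Proof.
apply: smooth_vfield_of_local; apply: (smooth_on_eq oO _ (smooth_on_cst oO a)).
by move=> z Oz; rewrite local_const_vfield.
Qed.

End LocalFields.

(** * Sprays in coordinates *)

Section LocalSpray.
Context (R : realType) (V : normedModType R) (finV : fin_dim V).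
Local Notation E := (V * V)%type.
Let finE : fin_dim E := fin_dim_prod finV finV.
Context (O : set E) (oO : open O) (g : E -> V) (sg : smooth_on O g).
Implicit Types (X Y : E -> E) (z : E).

Definition coord_lie X Y z : E := 'D_(X z) Y z - 'D_(Y z) X z.

(** Components (y, - 2 g) of a spray. *)
Definition spray_coefs (z : E) : E := (z.2, - (2 *: g z)).

(** Components of the horizontal lift of Y, the connection coefficients being the
    first vertical derivatives of g. *)
Definition coord_hor (Y : E -> V) z : E := (Y z, - 'D_(vert (Y z)) g z).

(** The vertical part of X relative to the same connection. *)
Definition coord_K X z : V := (X z).2 + 'D_(vert (X z).1) g z.

(** Flat differentiation along X, corrected by the second vertical derivative of g
    paired with the horizontal part of X. *)
Definition coord_berwald X (Y : E -> V) z : V :=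
  'D_(X z) Y z + 'D_(vert (Y z)) (fun y => 'D_(vert (X z).1) g y) z.

Definition third_vert (F : normedModType R) (f : E -> F) (a b c : V) z : F :=
  'D_(vert c) (fun y => 'D_(vert b) (fun x => 'D_(vert a) f x) y) z.

Let dg z : O z -> differentiable g z. Proof. exact: smooth_on_diff. Qed.

Let l1 := @linmap_fst R V V.
Let l2 := @linmap_snd R V V.
Let lv := @linmap_vert R V.

Lemma pair_subv (a b w : V) : (a, b) - vert w = (a, b - w).
Proof. by congr (_, _); rewrite /= subr0. Qed.

Lemma pair_subv2 (a b w w' : V) :
  (a, b) - vert w - vert w' = (a, b - w - w').
Proof. by rewrite (pair_subv a b w) (pair_subv a (b - w) w'). Qed.

Lemma derive_vert (Y : E -> V) z v : differentiable Y z ->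
  'D_v (fun y => vert (Y y)) z = vert ('D_v Y z).
Proof. exact: (derive_linmap v lv). Qed.

Lemma diff_vert (Y : E -> V) z : differentiable Y z ->
  differentiable (fun y => vert (Y y)) z.
Proof. by move=> dY; apply: (differentiable_comp dY); case: lv. Qed.

Lemma derive_fst X z v : differentiable X z ->
  'D_v (fun y => (X y).1) z = ('D_v X z).1.
Proof. exact: (derive_linmap v l1). Qed.

Lemma diff_fst X z : differentiable X z -> differentiable (fun y => (X y).1) z.
Proof. by move=> dX; apply: (differentiable_comp dX); case: l1. Qed.

Lemma derive_opp (Y : E -> V) z v : differentiable Y z ->
  'D_v (fun y => - Y y) z = - 'D_v Y z.
Proof. by move=> dY; rewrite -deriveN //; exact: diff_derivable. Qed.

Lemma derive_spray z v : O z ->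
  'D_v spray_coefs z = (v.2, - (2 *: 'D_v g z)) /\ differentiable spray_coefs z.
Proof.
move=> Oz; have dz := dg Oz.
have [d2 e2] := l2.
have ds : differentiable (fun y => 2 *: g y) z by apply: differentiable_comp.
have dns : differentiable (fun y => - (2 *: g y)) z by exact: differentiableN.
split; last exact: differentiable_pair.
rewrite (derive_pair v (d2 z) dns) e2 (derive_opp v ds); congr (_, - _).
exact: (derive_linmap v (@linmap_scale R V 2) dz).
Qed.

(** The derivatives of X in the two brackets cancel, so the Barthel connection is
    tensorial. *)
Lemma coord_barthel X z : O z -> differentiable X z ->
  coord_lie (fun y => vert (X y).1) spray_coefs z
    - vert (coord_lie X spray_coefs z).1
  = ((X z).1, - (2 *: 'D_(vert (X z).1) g z) - (X z).2).
Proof.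
move=> Oz dX; rewrite /coord_lie !(derive_spray _ Oz).1.
rewrite (derive_vert _ (diff_fst dX)) (derive_fst _ dX).
rewrite pair_subv2; congr (_, _).
by rewrite /= opprB addrA subrK.
Qed.

Lemma derive_coord_hor (Y : E -> V) z v : O z -> differentiable Y z ->
  'D_v (coord_hor Y) z = ('D_v Y z, - 'D_v (fun y => 'D_(vert (Y y)) g y) z)
  /\ differentiable (coord_hor Y) z.
Proof.
move=> Oz dY.
have da : differentiable (fun y => 'D_(vert (Y y)) g y) z.
  exact: (smooth_diff_along oO finE sg Oz (diff_vert dY)).
have dn := differentiableN da.
split; last exact: (differentiable_pair dY dn).
by rewrite (derive_pair v dY dn) (derive_opp v da).
Qed.

(** The derivatives of X1 produced by the bracket are removed by K: what remains
    is tensorial in X1. *)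
Lemma coord_berwald_hor (X1 Y : E -> V) z : O z ->
  differentiable X1 z -> differentiable Y z ->
  coord_K (coord_lie (coord_hor X1) (fun y => vert (Y y))) z
  = 'D_(coord_hor X1 z) Y z
    + 'D_(vert (Y z)) (fun y => 'D_(vert (X1 z)) g y) z.
Proof.
move=> Oz dX dY; have dz := dg Oz.
rewrite /coord_K /coord_lie (derive_vert _ dY) (derive_coord_hor _ Oz dX).1 /=.
rewrite (smooth_derive_along oO _ finE sg Oz (diff_vert dX)) (derive_vert _ dX).
have -> : vert (0 - 'D_(vert (Y z)) X1 z) = - vert ('D_(vert (Y z)) X1 z).
  by rewrite sub0r; apply/eqP; rewrite /vert /= xpair_eqE /= oppr0 !eqxx.
have -> : 'D_(- vert ('D_(vert (Y z)) X1 z)) g z = - 'D_(vert ('D_(vert (Y z)) X1 z)) g z.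
  by rewrite -scaleN1r derive_linZ // scaleN1r.
by rewrite opprK -addrA addrAC subrr add0r.
Qed.

Lemma coord_berwald_vert (Y Z : E -> V) z :
  coord_berwald (fun y => vert (Y y)) Z z = 'D_(vert (Y z)) Z z.
Proof.
rewrite /coord_berwald /=.
have -> : (fun y => 'D_(vert (0 : V)) g y) = cst 0.
  by apply/funext => y; exact: derive0.
by rewrite derive_cst addr0.
Qed.

Let smooth_vert (Y : E -> V) :
  smooth_on O Y -> smooth_on O (fun y => vert (Y y)).
Proof. exact: (smooth_on_linmap_comp oO lv). Qed.

Let smooth_along (F : normedModType R) (f : E -> F) (w : E -> E) :
  smooth_on O f -> smooth_on O w -> smooth_on O (fun y => 'D_(w y) f y).
Proof.
move=> sf sw.
apply: (smooth_on_along oO (p := id) finE (fun _ h => h) sf _ sw).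
exact: (smooth_on_linmap oO (@linmap_id _ _)).
Qed.

Lemma smooth_coord_hor (Y : E -> V) : smooth_on O Y -> smooth_on O (coord_hor Y).
Proof.
move=> sY; apply: (smooth_on_pair oO sY); apply: (smooth_onN oO).
exact: smooth_along sg (smooth_vert sY).
Qed.

Lemma smooth_coord_lie X Y :
  smooth_on O X -> smooth_on O Y -> smooth_on O (coord_lie X Y).
Proof.
by move=> sX sY; apply: (smooth_onB oO); apply: smooth_along.
Qed.

Lemma smooth_coord_berwald X (Y : E -> V) :
  smooth_on O X -> smooth_on O Y -> smooth_on O (coord_berwald X Y).
Proof.
move=> sX sY; apply: (smooth_onD oO); first exact: smooth_along.
have sX1 : smooth_on O (fun y => (X y).1).
  exact: (smooth_on_linmap_comp oO l1 sX).
exact: (smooth_on_along2 oO finE sg (smooth_vert sX1) (smooth_vert sY)).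
Qed.

(** The curvature of a flat connection corrected by a matrix-valued form. Here the
    form vanishes on vertical vectors, so its only surviving contribution is its
    own derivative along vert Y, a third derivative of g; the second derivatives of
    Z cancel by symmetry and the first ones by Leibniz' rule. *)
Lemma coord_curvature (X Y Z : E -> V) z :
  smooth_on O X -> smooth_on O Y -> smooth_on O Z -> O z ->
  - coord_berwald (coord_hor X) (coord_berwald (fun y => vert (Y y)) Z) z
  + coord_berwald (fun y => vert (Y y)) (coord_berwald (coord_hor X) Z) z
  + coord_berwald (coord_lie (coord_hor X) (fun y => vert (Y y))) Z z
  = third_vert g (X z) (Z z) (Y z) z.
Proof.
move=> sX sY sZ Oz; set vY := fun y => vert (Y y).
have svY := smooth_vert sY; have shX := smooth_coord_hor sX.
have svX := smooth_vert sX; have svZ := smooth_vert sZ.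
have dX := smooth_on_diff sX Oz; have dY := smooth_on_diff sY Oz.
have dZ := smooth_on_diff sZ Oz.
have dvY := smooth_on_diff svY Oz; have dhX := smooth_on_diff shX Oz.
(* p1, p2 and r, s carry first derivatives of Z and X, Z; q is the mixed second
   derivative of Z *)
set p1 := 'D_('D_(coord_hor X z) vY z) Z z.
set p2 := 'D_('D_(vY z) (coord_hor X) z) Z z.
set q := 'D_(coord_hor X z) (fun y => 'D_(vY z) Z y) z.
set r := 'D_(vert ('D_(vY z) Z z)) (fun y => 'D_(vert (X z)) g y) z.
set s := 'D_(vert (Z z)) (fun y => 'D_(vert ('D_(vY z) X z)) g y) z.
have bY : coord_berwald vY Z = fun y => 'D_(vY y) Z y.
  by apply/funext => y; exact: coord_berwald_vert.
have -> : coord_berwald (coord_hor X) (coord_berwald vY Z) z = p1 + q + r.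
  rewrite bY /coord_berwald; congr (_ + _).
  exact: (smooth_derive_along oO _ finE sZ Oz dvY).
have -> : coord_berwald vY (coord_berwald (coord_hor X) Z) z
    = (p2 + q) + (third_vert g (X z) (Z z) (Y z) z + s + r).
  rewrite (coord_berwald_vert Y) /coord_berwald.
  have sa := smooth_along sZ shX.
  have sb := smooth_on_along2 oO finE sg svX svZ.
  rewrite deriveD; [|exact: diff_derivable (smooth_on_diff sa Oz)
                    |exact: diff_derivable (smooth_on_diff sb Oz)].
  congr (_ + _).
    rewrite (smooth_derive_along oO _ finE sZ Oz dhX); congr (_ + _).
    exact: (smooth_on_schwarz oO _ _ finV sZ Oz).
  rewrite (smooth_derive_along2 oO _ finE sg svX svZ Oz).
  by rewrite (derive_vert _ dX) (derive_vert _ dZ).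
have -> : coord_berwald (coord_lie (coord_hor X) vY) Z z = (p1 - p2) + (- s).
  rewrite /coord_berwald /coord_lie (derive_linB _ _ dZ); congr (_ + _).
  have ls := smooth_second_linmap oO (vert (Z z)) finV sg Oz.
  rewrite (derive_vert _ dY) (derive_coord_hor _ Oz dX).1 /= sub0r.
  rewrite -(scaleN1r ('D_(vY z) X z)) (linmapZ _ lv).
  by rewrite (linmapZ (-1) ls) scaleN1r.
move: p1 p2 q r s (third_vert _ _ _ _ _) => p1 p2 q r s t.
rewrite !opprD !addrA.
rewrite (ACl (6*(1*9)*(2*5)*(3*8)*(4*10)*(7*11))%AC).
by rewrite /= !addNr !subrr !addr0.
Qed.

End LocalSpray.

(** * The Berwald connection in a chart *)

Section SprayInChart.
Context (R : realType) (n : nat) (M : topologicalType) (A : atlas M 'rV[R]_n).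
Hypothesis (SA : smooth_atlas A).
Local Notation V := 'rV[R]_n.
Local Notation TM := (M * 'rV[R]_n)%type.
Local Notation TTM := ('rV[R]_n * 'rV[R]_n)%type.
Local Notation TA := (tangent_atlas A).

Let finV : fin_dim V := fin_dim_rV R n.
Let finE : fin_dim TTM := fin_dim_prod finV finV.
Let ST : smooth_atlas TA := tangent_smooth_atlas finV SA.

Context (i : chart_index A) (W : set TM).
Hypotheses (oW : atlas_open TA W) (Wi : W `<=` source TA i)
  (Ws : W `<=` @slit R n M).
Local Notation O := (coord_image i W).
Let oO : open O := open_coord_image oW.
Local Notation lf := (@local_vfield R n M A i).
Local Notation lp := (@local_pifield R n M A i).

Context (G : TM -> TTM) (g : TTM -> V).
Hypotheses (sg : smooth_on O g)
  (Gg : forall z, O z -> lf G z = spray_coefs g z).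

Let lv := @linmap_vert R V.
Let l1 := @linmap_fst R V V.

(** Fields known on the whole chart domain may be replaced by their expressions
    inside a bracket. *)
Lemma local_lie_bracket_eq X Y (f h : TTM -> TTM) z : O z ->
  (forall y, O y -> lf X y = f y) -> (forall y, O y -> lf Y y = h y) ->
  differentiable f z -> differentiable h z ->
  lf (lie_bracket TA X Y) z = coord_lie f h z.
Proof.
move=> Oz Xf Yh df dh.
have dX := local_vfield_diff oW Oz Xf df; have dY := local_vfield_diff oW Oz Yh dh.
rewrite (local_lie_bracket SA Wi Oz dX dY) /coord_lie (Xf _ Oz) (Yh _ Oz).
exact (congr2 (fun a b : TTM => a - b)
  (local_vfield_derive oW _ Oz Yh) (local_vfield_derive oW _ Oz Xf)).
Qed.

Lemma local_barthel X z : O z -> differentiable (lf X) z ->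
  lf (barthel A G X) z
    = ((lf X z).1, - (2 *: 'D_(vert (lf X z).1) g z) - (lf X z).2).
Proof.
move=> Oz dX; rewrite -(coord_barthel sg Oz dX).
have dJ : differentiable (fun y => vert (lf X y).1) z by exact: diff_vert (diff_fst dX).
have EJ y : O y -> lf (J A X) y = vert (lf X y).1 by exact: local_J.
have dG := (derive_spray sg 0 Oz).2.
have L1 := local_lie_bracket_eq Oz EJ Gg dJ dG.
have L2 : lf (J A (lie_bracket TA X G)) z
    = vert (coord_lie (lf X) (spray_coefs g) z).1.
  by rewrite (local_J SA Wi _ Oz) (local_lie_bracket_eq Oz (fun y _ => erefl) Gg dX dG).
rewrite -L1 -L2; have [u Wu zu] := coord_imageP Oz; rewrite zu.
rewrite !(local_vfield_chart SA Wi _ Wu) /barthel.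
exact: (linmapB (linmap_components ST (Wi Wu))).
Qed.

Lemma local_hproj X z : O z -> differentiable (lf X) z ->
  lf (hproj A G X) z = ((lf X z).1, - 'D_(vert (lf X z).1) g z).
Proof.
move=> Oz dX; have B := local_barthel Oz dX.
have [u Wu zu] := coord_imageP Oz.
have lc := linmap_components ST (Wi Wu).
have -> : lf (hproj A G X) z = 2^-1 *: (lf X z + lf (barthel A G X) z).
  rewrite zu !(local_vfield_chart SA Wi _ Wu) /hproj (linmapZ _ lc); congr (_ *: _).
  exact: (linmapD lc).
rewrite B; move: (lf X z) => [a b]; rewrite /=.
set d := 'D_ _ g z.
transitivity (2^-1 *: (a + a), 2^-1 *: (b + (- (2 *: d) - b))) => //.
have h2 (w : V) : 2^-1 *: (2 *: w) = w.
  by rewrite scalerA mulVf ?scale1r // pnatr_eq0.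
congr (_, _); first by rewrite -mulr2n -[a *+ 2]scaler_nat h2.
by rewrite addrC subrK scalerN h2.
Qed.

Lemma local_vproj X z : O z -> differentiable (lf X) z ->
  lf (vproj A G X) z = vert (coord_K g (lf X) z).
Proof.
move=> Oz dX; have B := local_barthel Oz dX.
have [u Wu zu] := coord_imageP Oz.
have lc := linmap_components ST (Wi Wu).
have -> : lf (vproj A G X) z = 2^-1 *: (lf X z - lf (barthel A G X) z).
  rewrite zu !(local_vfield_chart SA Wi _ Wu) /vproj (linmapZ _ lc); congr (_ *: _).
  exact: (linmapB lc).
rewrite B /coord_K; move: (lf X z) => [a b]; rewrite /=.
set d := 'D_ _ g z.
transitivity (2^-1 *: (a - a), 2^-1 *: (b - (- (2 *: d) - b))) => //.
have h2 (w : V) : 2^-1 *: (2 *: w) = w.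
  by rewrite scalerA mulVf ?scale1r // pnatr_eq0.
rewrite subrr scaler0 /vert; congr (_, _).
by rewrite opprB opprK addrA -mulr2n -[b *+ 2]scaler_nat -scalerDr h2.
Qed.

Lemma tangent_components_inj u xi xi' : W u ->
  components (A := TA) i u xi = components (A := TA) i u xi' -> xi = xi'.
Proof. by move=> /Wi iu; exact: (components_inj ST iu). Qed.

(** beta is a choice of a horizontal vector above Y u. A horizontal vector has
    components (X, - D_(0, X) g), hence is determined by its image under rho;
    existence is witnessed by the horizontal part of a coordinate field. *)
Lemma local_beta Y z : O z -> lf (beta A G Y) z = coord_hor g (lp Y) z.
Proof.
move=> Oz; have [u Wu zu] := coord_imageP Oz.
rewrite zu (local_vfield_chart SA Wi _ Wu) /beta.
set P := [set xi | _].
have iu : source A i u.1 := Wi Wu.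
have : P (xget 0 P).
  apply: xgetPex.
  pose X := const_vfield i (lp Y z, 0 : V) : TM -> TTM.
  exists (hproj A G X u); split.
    exists W, X; split; [exact: conj|exact: Wu| |reflexivity].
    exact: smooth_const_vfield.
  rewrite rhoE //; apply: (components_inj SA iu).
  rewrite -(tangent_components1 finV SA) // -(local_vfield_chart SA Wi _ Wu) -zu.
  have EX y : O y -> lf X y = (lp Y z, 0) by exact: local_const_vfield.
  have dX : differentiable (lf X) z.
    apply: (local_vfield_diff oW Oz (f := cst (lp Y z, 0))) => //.
  by rewrite (local_hproj Oz dX) (EX _ Oz) /= zu (local_pifield_chart SA Wi _ Wu).
move: (xget 0 P) => xi [[W' [X [[oW' W's] W'u sX ->]]]].
rewrite rhoE // => Yu.
have dX : differentiable (lf X) z.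
  rewrite zu; apply: (smooth_on_diff (sX i)).
  by exists u => //; split=> //; exact: Wi.
have H : components (A := TA) i u (hproj A G X u)
    = ((lf X z).1, - 'D_(vert (lf X z).1) g z).
  by rewrite -(local_vfield_chart SA Wi _ Wu) -zu; exact: local_hproj.
have E1 : (lf X z).1 = lp Y z.
  rewrite [in RHS]zu (local_pifield_chart SA Wi Y Wu) -Yu.
  exact: (etrans (esym (congr1 fst H))
            (tangent_components1 finV SA (hproj A G X u) (Wi Wu))).
apply: (etrans H); rewrite E1; exact: (congr1 (coord_hor g (lp Y)) zu).
Qed.

Lemma local_K X z : O z -> differentiable (lf X) z ->
  lp (K A G X) z = coord_K g (lf X) z.
Proof.
move=> Oz dX; have [u Wu zu] := coord_imageP Oz.
rewrite [LHS](_ : _ = components (A := A) i u.1 (K A G X u)); last first.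
  by rewrite zu (local_pifield_chart SA Wi _ Wu).
rewrite /K; set P := [set w | _].
have iu : source A i u.1 := Wi Wu.
have cv w : components (A := TA) i u (vlift A u w) = vert (components (A := A) i u.1 w).
  by rewrite (vliftE SA); exact: (tangent_components_vertical finV SA w iu).
have H := local_vproj Oz dX; rewrite [in LHS]zu (local_vfield_chart SA Wi _ Wu) in H.
have : P (xget 0 P).
  apply: xgetPex; exists (vector_of_components (A := A) i u.1 (coord_K g (lf X) z)).
  by apply: (tangent_components_inj Wu); rewrite cv H (vector_of_componentsK SA iu).
move: (xget 0 P) => w Pw; have := congr1 (components (A := TA) i u) Pw.
by rewrite cv H => /(congr1 snd).
Qed.

Lemma smooth_coord_K X : smooth_on O (lf X) -> smooth_on O (coord_K g (lf X)).
Proof.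
move=> sX.
have sX1 : smooth_on O (fun y => (lf X y).1).
  exact: (smooth_on_linmap_comp oO l1 sX).
have sv : smooth_on O (fun y => vert (lf X y).1).
  exact: (smooth_on_linmap_comp oO lv sX1).
apply: (smooth_onD oO).
  exact: (smooth_on_linmap_comp oO (@linmap_snd R V V) sX).
apply: (smooth_on_along oO (p := id) finE (fun _ h => h) sg _ sv).
exact: (smooth_on_linmap oO (@linmap_id _ _)).
Qed.

Lemma local_berwald X Y z : O z -> smooth_on O (lf X) -> smooth_on O (lp Y) ->
  lp (berwald A G X Y) z = coord_berwald g (lf X) (lp Y) z.
Proof.
move=> Oz sX sY.
have sK := smooth_coord_K sX.
have EgK y : O y -> lf (gammaF A (K A G X)) y = vert (coord_K g (lf X) y).
  move=> Oy; rewrite (local_gammaF SA Wi _ Oy) local_K //; exact: smooth_on_diff sX Oy.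
have EbY y : O y -> lf (beta A G Y) y = coord_hor g (lp Y) y by exact: local_beta.
have EbX y : O y -> lf (beta A G (rhoF A X)) y
    = coord_hor g (fun y => (lf X y).1) y.
  by move=> Oy; rewrite (local_beta (rhoF A X) Oy) /coord_hor (local_rhoF SA Wi X Oy).
have EgY y : O y -> lf (gammaF A Y) y = vert (lp Y y) by exact: local_gammaF.
have dK := smooth_on_diff sK Oz; have dY := smooth_on_diff sY Oz.
have dX1 := diff_fst (smooth_on_diff sX Oz).
have dgK := diff_vert dK.
have [DbY dbY] := derive_coord_hor finV oO sg (vert (coord_K g (lf X) z)) Oz dY.
have [u Wu zu] := coord_imageP Oz.
have iu : source A i u.1 := Wi Wu.
have lc := linmap_components SA iu.
have -> : lp (berwald A G X Y) z
  = lp (rhoF A (lie_bracket TA (gammaF A (K A G X)) (beta A G Y))) z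
    + lp (K A G (lie_bracket TA (beta A G (rhoF A X)) (gammaF A Y))) z.
  by rewrite zu !(local_pifield_chart SA Wi _ Wu) /berwald (linmapD lc).
have -> : lp (rhoF A (lie_bracket TA (gammaF A (K A G X)) (beta A G Y))) z
    = 'D_(vert (coord_K g (lf X) z)) (lp Y) z.
  rewrite (local_rhoF SA Wi _ Oz) (local_lie_bracket_eq Oz EgK EbY dgK dbY) /coord_lie.
  by rewrite DbY (derive_vert _ dK) /= subr0.
have sX1 : smooth_on O (fun y => (lf X y).1).
  exact: (smooth_on_linmap_comp oO l1 sX).
have shX := smooth_coord_hor finV oO sg sX1.
have svY : smooth_on O (fun y => vert (lp Y y)).
  exact: (smooth_on_linmap_comp oO lv sY).
have EL y : O y -> lf (lie_bracket TA (beta A G (rhoF A X)) (gammaF A Y)) y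
    = coord_lie (coord_hor g (fun y => (lf X y).1)) (fun y => vert (lp Y y)) y.
  move=> Oy.
  exact: (local_lie_bracket_eq Oy EbX EgY (smooth_on_diff shX Oy) (smooth_on_diff svY Oy)).
have sL := smooth_coord_lie finV oO shX svY.
have LK := etrans (local_K Oz (local_vfield_diff oW Oz EL (smooth_on_diff sL Oz)))
  (etrans (congr1 (fun w : TTM => w.2 + 'D_(vert w.1) g z) (EL _ Oz))
     (coord_berwald_hor finV oO sg Oz dX1 dY)).
have XE : vert (coord_K g (lf X) z) + coord_hor g (fun y => (lf X y).1) z = lf X z.
  rewrite [RHS]surjective_pairing; congr (_, _); first exact: add0r.
  exact: addrK.
have DX := etrans (esym (derive_linD _ _ dY))
  (congr1 (fun w => 'D_w (lp Y) z) XE).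
apply: (etrans (congr1 (fun w => _ + w) LK)).
by apply: (etrans (addrA _ _ _)); exact: (congr1 (fun w => w + _) DX).
Qed.

Lemma local_berwald_eq X Y (f : TTM -> TTM) (h : TTM -> V) z : O z ->
  smooth_on O f -> smooth_on O h ->
  (forall y, O y -> lf X y = f y) -> (forall y, O y -> lp Y y = h y) ->
  lp (berwald A G X Y) z = coord_berwald g f h z.
Proof.
move=> Oz sf sh Xf Yh.
have sX : smooth_on O (lf X).
  by apply: (smooth_on_eq oO _ sf) => y Oy; rewrite Xf.
have sY : smooth_on O (lp Y).
  by apply: (smooth_on_eq oO _ sh) => y Oy; rewrite Yh.
rewrite (local_berwald Oz sX sY) /coord_berwald (Xf _ Oz) (Yh _ Oz).
by congr (_ + _); exact (local_pifield_derive oW _ Oz Yh).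
Qed.

Lemma local_hv_curvature X Y Z z : O z ->
  smooth_on O (lp X) -> smooth_on O (lp Y) -> smooth_on O (lp Z) ->
  lp (hv_curvature A G X Y Z) z = third_vert g (lp X z) (lp Z z) (lp Y z) z.
Proof.
move=> Oz sX sY sZ; rewrite -(coord_curvature finV oO sg sX sY sZ Oz).
have svY : smooth_on O (fun y => vert (lp Y y)).
  exact: (smooth_on_linmap_comp oO lv sY).
have shX := smooth_coord_hor finV oO sg sX.
have EbX y : O y -> lf (beta A G X) y = coord_hor g (lp X) y by exact: local_beta.
have EgY y : O y -> lf (gammaF A Y) y = vert (lp Y y) by exact: local_gammaF.
have EL y : O y -> lf (lie_bracket TA (beta A G X) (gammaF A Y)) y
    = coord_lie (coord_hor g (lp X)) (fun y => vert (lp Y y)) y.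
  move=> Oy.
  exact: (local_lie_bracket_eq Oy EbX EgY (smooth_on_diff shX Oy) (smooth_on_diff svY Oy)).
have sLl := smooth_coord_lie finV oO shX svY.
have [u Wu zu] := coord_imageP Oz.
have lc := linmap_components SA (Wi Wu : source A i u.1).
have -> : lp (hv_curvature A G X Y Z) z =
   - lp (berwald A G (beta A G X) (berwald A G (gammaF A Y) Z)) z
   + lp (berwald A G (gammaF A Y) (berwald A G (beta A G X) Z)) z
   + lp (berwald A G (lie_bracket TA (beta A G X) (gammaF A Y)) Z) z.
  have cE (a b c : V) : components (A := A) i u.1 (- a + b + c)
      = - components (A := A) i u.1 a + components (A := A) i u.1 b
        + components (A := A) i u.1 c.
    by rewrite !(linmapD lc) -scaleN1r (linmapZ _ lc) scaleN1r.
  have L (Y' : TM -> V) : lp Y' z = components (A := A) i u.1 (Y' u).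
    by rewrite zu; exact: (local_pifield_chart SA Wi Y' Wu).
  exact: (etrans (L _) (etrans (cE _ _ _) (esym
    (congr2 +%R (congr2 +%R (congr1 -%R (L _)) (L _)) (L _))))).
have C1 y : O y -> lp (berwald A G (gammaF A Y) Z) y
    = coord_berwald g (fun y => vert (lp Y y)) (lp Z) y.
  by move=> Oy; exact: (local_berwald_eq Oy svY sZ EgY (fun _ _ => erefl)).
have C2 y : O y -> lp (berwald A G (beta A G X) Z) y
    = coord_berwald g (coord_hor g (lp X)) (lp Z) y.
  by move=> Oy; exact: (local_berwald_eq Oy shX sZ EbX (fun _ _ => erefl)).
congr (_ + _); first congr (_ + _); first congr (- _).
- exact: (local_berwald_eq Oz shX (smooth_coord_berwald finV oO sg svY sZ) EbX C1).
- exact: (local_berwald_eq Oz svY (smooth_coord_berwald finV oO sg shX sZ) EgY C2).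
- exact: (local_berwald_eq Oz sLl sZ EL (fun _ _ => erefl)).
Qed.

End SprayInChart.

(** * Third vertical derivatives under a projective change *)

Section ProjectiveChange.
Context (R : realType) (V : normedModType R) (finV : fin_dim V).
Local Notation E := (V * V)%type.
Context (O : set E) (oO : open O).
Implicit Types (z : E) (a b c : V).

Lemma derive_scale_snd (m : E -> R^o) a z : differentiable m z ->
  'D_(vert a) (fun y => m y *: y.2) z = 'D_(vert a) m z *: z.2 + m z *: a.
Proof.
move=> dm; have [d2 e2] := @linmap_snd R V V.
by rewrite (derive_scale _ dm (d2 z)) e2.
Qed.

Lemma derive_scale_cst (m : E -> R^o) a v z : differentiable m z ->
  'D_v (fun y => m y *: a) z = 'D_v m z *: a.
Proof. by move=> dm; exact: (derive_linmap v (linmap_scalel a) dm). Qed.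

(** Leibniz' rule for m y, in which y is linear in the fibre: the four extra terms
    are those of the Douglas tensor. *)
Lemma third_vert_projective (g : E -> V) (m : E -> R^o) a b c z :
  smooth_on O g -> smooth_on O m -> O z ->
  third_vert (fun y => g y + m y *: y.2) a b c z
  = third_vert g a b c z + third_vert m a b c z *: z.2
    + 'D_(vert b) (fun y => 'D_(vert a) m y) z *: c
    + 'D_(vert c) (fun y => 'D_(vert a) m y) z *: b
    + 'D_(vert c) (fun y => 'D_(vert b) m y) z *: a.
Proof.
move=> sg sm Oz; rewrite /third_vert.
have s2 := smooth_on_linmap oO (@linmap_snd R V V).
have sD (F : normedModType R) (f : E -> F) v : smooth_on O f ->
    smooth_on O (fun y => 'D_v f y) by exact: smooth_on_derive.
have dd (F : normedModType R) (f : E -> F) y v : smooth_on O f -> O y ->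
    derivable f y v.
  by move=> sf Oy; apply: diff_derivable; exact: smooth_on_diff sf Oy.
have sms (k : E -> R^o) : smooth_on O k -> smooth_on O (fun y => k y *: y.2).
  by move=> sk; exact: (smooth_on_scale oO sk s2).
have smc (k : E -> R^o) w : smooth_on O k -> smooth_on O (fun y => k y *: w).
  move=> sk; exact: (smooth_on_scale oO sk (smooth_on_cst oO w)).
have E1 y : O y -> 'D_(vert a) (fun y => g y + m y *: y.2) y
    = 'D_(vert a) g y + ('D_(vert a) m y *: y.2 + m y *: a).
  move=> Oy; rewrite (deriveD (dd _ _ _ _ sg Oy) (dd _ _ _ _ (sms _ sm) Oy)).
  by rewrite (derive_scale_snd _ (smooth_on_diff sm Oy)).
have ma := sD _ _ (vert a) sm; have mb := sD _ _ (vert b) sm.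
have ga := sD _ _ (vert a) sg; have gb := sD _ _ (vert b) ga.
have mab := sD _ _ (vert b) ma.
have E2 y : O y ->
    'D_(vert b) (fun y => 'D_(vert a) (fun y => g y + m y *: y.2) y) y
    = 'D_(vert b) (fun y => 'D_(vert a) g y) y
      + ('D_(vert b) (fun y => 'D_(vert a) m y) y *: y.2
         + 'D_(vert a) m y *: b + 'D_(vert b) m y *: a).
  move=> Oy; rewrite (near_eq_derive _ (open_near oO Oy E1)).
  have s1 := smooth_onD oO (sms _ ma) (smc _ _ a sm).
  rewrite (deriveD (dd _ _ _ _ ga Oy) (dd _ _ _ _ s1 Oy)).
  rewrite (deriveD (dd _ _ _ _ (sms _ ma) Oy) (dd _ _ _ _ (smc _ _ a sm) Oy)).
  rewrite (derive_scale_snd _ (smooth_on_diff ma Oy)).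
  by rewrite (derive_scale_cst _ _ (smooth_on_diff sm Oy)).
rewrite (near_eq_derive _ (open_near oO Oz E2)).
have t1 := sms _ mab; have t2 := smc _ _ b ma; have t3 := smc _ _ a mb.
have t12 := smooth_onD oO t1 t2; have t123 := smooth_onD oO t12 t3.
rewrite (deriveD (dd _ _ _ _ gb Oz) (dd _ _ _ _ t123 Oz)).
rewrite (deriveD (dd _ _ _ _ t12 Oz) (dd _ _ _ _ t3 Oz)).
rewrite (deriveD (dd _ _ _ _ t1 Oz) (dd _ _ _ _ t2 Oz)).
rewrite (derive_scale_snd _ (smooth_on_diff mab Oz)).
rewrite (derive_scale_cst _ _ (smooth_on_diff ma Oz)).
rewrite (derive_scale_cst _ _ (smooth_on_diff mb Oz)).
by rewrite !addrA.
Qed.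

End ProjectiveChange.

(** * Functions and the two-form of the energy in a chart *)

Section FunctionsInChart.
Context (R : realType) (n : nat) (M : topologicalType) (A : atlas M 'rV[R]_n).
Hypothesis (SA : smooth_atlas A).
Local Notation V := 'rV[R]_n.
Local Notation TM := (M * 'rV[R]_n)%type.
Local Notation TTM := ('rV[R]_n * 'rV[R]_n)%type.
Local Notation TA := (tangent_atlas A).

Let finV : fin_dim V := fin_dim_rV R n.
Let finE : fin_dim TTM := fin_dim_prod finV finV.
Let ST : smooth_atlas TA := tangent_smooth_atlas finV SA.

Context (i : chart_index A) (W : set TM).
Hypotheses (oW : atlas_open TA W) (Wi : W `<=` source TA i).
Local Notation O := (coord_image i W).
Let oO : open O := open_coord_image oW.
Local Notation lf := (@local_vfield R n M A i).
Local Notation lp := (@local_pifield R n M A i).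

Definition local_fun (f : TM -> R) : TTM -> R^o := f \o inv_chart TA i.
Local Notation lfun := local_fun.

Lemma local_fun_chart f u : W u -> lfun f (chart TA i u) = f u.
Proof. by move=> /Wi iu; exact: (congr1 f (atlas_chartK ST iu)). Qed.

Lemma smooth_local_fun f : smooth_fun TA W (f : TM -> R^o) -> smooth_on O (lfun f).
Proof. by move=> sf; exact: sf i. Qed.

Lemma vderive_chart X f u : W u -> differentiable (lfun f) (chart TA i u) ->
  vderive TA X f u
    = 'D_(lf X (chart TA i u)) (lfun f) (chart TA i u).
Proof.
move=> Wu df; rewrite (local_vfield_chart SA Wi X Wu).
exact: (vderiveE ST X (Wi Wu) df).
Qed.

Lemma local_fun_vderive X f y : O y -> smooth_on O (lfun f) ->
  lfun (vderive TA X f) y = 'D_(lf X y) (lfun f) y.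
Proof.
move=> Oy sf; have [u Wu yu] := coord_imageP Oy.
rewrite yu (local_fun_chart _ Wu); apply: (vderive_chart X Wu).
by apply: (smooth_on_diff sf); rewrite -yu.
Qed.

Lemma vderive_local X f (h : TTM -> R^o) u : W u ->
  (forall y, O y -> lfun f y = h y) -> differentiable h (chart TA i u) ->
  vderive TA X f u = 'D_(lf X (chart TA i u)) h (chart TA i u).
Proof.
move=> Wu fh dh; have Oz := mem_coord_image Wi Wu.
have nf := open_near oO Oz fh.
have nh : \forall y \near chart TA i u, h y = lfun f y.
  by apply: filterS nf.
rewrite (vderive_chart X Wu (near_differentiable nh dh)).
exact: near_eq_derive nf.
Qed.

Lemma local_d_J X f y : O y -> smooth_on O (lfun f) ->
  lfun (d_J A f X) y = 'D_(vert (lf X y).1) (lfun f) y.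
Proof.
move=> Oy sf; rewrite -(local_J SA Wi X Oy).
exact: (local_fun_vderive (J A X) Oy sf).
Qed.

(** In coordinates this is the two-form of second derivatives of f with one
    direction made vertical; the first-order terms cancel against the bracket. *)
Lemma ext_deriv_d_J f X Y u : W u -> smooth_on O (lfun f) ->
  let z := chart TA i u in
  differentiable (lf X) z -> differentiable (lf Y) z ->
  ext_deriv TA (d_J A f) X Y u
    = 'D_(lf X z) (fun y => 'D_(vert (lf Y z).1) (lfun f) y) z
      - 'D_(lf Y z) (fun y => 'D_(vert (lf X z).1) (lfun f) y) z.
Proof.
move=> Wu sf z dX dY; have Oz : O z := mem_coord_image Wi Wu.
have lv := @linmap_vert R V.
have dv (X' : TM -> TTM) : differentiable (lf X') z ->
    differentiable (fun y => vert (lf X' y).1) z.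
  by move=> dX'; exact: diff_vert (diff_fst dX').
have D (X' Y' : TM -> TTM) : differentiable (lf X') z ->
  vderive TA Y' (d_J A f X') u
    = 'D_(vert ('D_(lf Y' z) (lf X') z).1) (lfun f) z
      + 'D_(lf Y' z) (fun y => 'D_(vert (lf X' z).1) (lfun f) y) z.
  move=> dX'.
  have H y : O y -> lfun (d_J A f X') y = 'D_(vert (lf X' y).1) (lfun f) y.
    by move=> Oy; exact: local_d_J.
  have P := vderive_local Y' Wu H (smooth_diff_along oO finE sf Oz (dv _ dX')).
  have Q := smooth_derive_along oO (lf Y' z) finE sf Oz (dv _ dX').
  have S : 'D_(lf Y' z) (fun y => vert (lf X' y).1) z
      = vert ('D_(lf Y' z) (lf X') z).1.
    exact: (etrans (derive_vert _ (diff_fst dX'))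
             (congr1 (@vert R V) (derive_fst _ dX'))).
  exact: (etrans P (etrans Q (congr1 (fun w => 'D_w (lfun f) z + _) S))).
have B : d_J A f (lie_bracket TA X Y) u
   = 'D_(vert ('D_(lf X z) (lf Y) z).1) (lfun f) z
     - 'D_(vert ('D_(lf Y z) (lf X) z).1) (lfun f) z.
  have vB (p q : TTM) : vert (p - q).1 = vert p.1 - vert q.1.
    exact: (linmapB lv).
  apply: (etrans (esym (local_fun_chart (d_J A f (lie_bracket TA X Y)) Wu))).
  apply: (etrans (local_d_J (lie_bracket TA X Y) Oz sf)).
  apply: (etrans _ (derive_linB _ _ (smooth_on_diff sf Oz))).
  apply: (congr1 (fun w => 'D_w (lfun f) z)).
  exact: (etrans (congr1 (fun w : TTM => vert w.1) (local_lie_bracket SA Wi Oz dX dY)) (vB _ _)).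
apply: (etrans (congr2 (fun p q => p - q)
  (congr2 (fun p q => p - q) (D Y X dY) (D X Y dX)) B)).
have E (p q r t : R) : p + r - (q + t) - (p - q) = r - t by ring.
exact: E.
Qed.

End FunctionsInChart.

(** * The canonical spray is a semispray *)

Section Semispray.
Context (R : realType) (n : nat) (M : topologicalType) (A : atlas M 'rV[R]_n).
Hypothesis (SA : smooth_atlas A).
Local Notation V := 'rV[R]_n.
Local Notation TM := (M * 'rV[R]_n)%type.
Local Notation TTM := ('rV[R]_n * 'rV[R]_n)%type.
Local Notation TA := (tangent_atlas A).

Let finV : fin_dim V := fin_dim_rV R n.
Let finE : fin_dim TTM := fin_dim_prod finV finV.
Let ST : smooth_atlas TA := tangent_smooth_atlas finV SA.

Lemma atlas_open_slit : atlas_open TA (@slit R n M).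
Proof.
move=> i; rewrite (_ : _ @` _ = (chart TA i @` (source TA i `&` source TA i))
    `&` (snd @^-1` [set y : V | y != 0])).
  apply: openI; first exact: (atlas_open_overlap ST i i).
  apply: open_comp; first by move=> x _; exact: cvg_snd.
  rewrite (_ : [set y : V | y != 0] = ~` [set 0]); last first.
    by apply/seteqP; split=> y /= /eqP.
  apply: closed_openC; apply: accessible_closed_set1.
  by apply: hausdorff_accessible; exact: norm_hausdorff.
apply/seteqP; split=> [_ [u [iu su] <-]|_ [[u [iu _] <-]] nu].
  split; first by exists u.
  rewrite /= ; apply: contra_neq su => /= c0.
  have lc := linmap_components SA (iu : source A i u.1).
  apply: (components_inj SA (iu : source A i u.1)).
  by rewrite c0 (linmap_0 lc).
exists u => //; split=> //; rewrite /slit /=; apply: contra_neq nu => /= u0.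
by rewrite u0; exact: linmap_0 (linmap_components SA (iu : source A i u.1)).
Qed.

Lemma energy_smooth (L : TM -> R) (W : set TM) : atlas_open TA W ->
  smooth_fun TA W (L : TM -> R^o) -> smooth_fun TA W (energy L : TM -> R^o).
Proof.
move=> oW sL i; have oi := oW i.
have := smooth_onZ oi (2^-1 : R) (smooth_on_scale oi (sL i) (sL i)).
exact: (smooth_on_eq oi).
Qed.

Context (i : chart_index A).
Definition chart_slit : set TM := @slit R n M `&` source TA i.
Local Notation W := chart_slit.

Lemma atlas_open_chart_slit : atlas_open TA W.
Proof.
exact: (atlas_open_setI ST atlas_open_slit (@atlas_open_source _ _ _ _ ST i)).
Qed.

Let oW := atlas_open_chart_slit.
Let Wi : W `<=` source TA i. Proof. by move=> u []. Qed.
Let Ws : W `<=` @slit R n M. Proof. by move=> u []. Qed.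
Local Notation O := (coord_image i W).
Let oO : open O := open_coord_image oW.
Local Notation lf := (@local_vfield R n M A i).
Local Notation lp := (@local_pifield R n M A i).
Local Notation lfun := (@local_fun R n M A i).

Context (L : TM -> R) (HL : finsler A L).
Local Notation e := (lfun (energy L)).

Lemma smooth_energy_chart : smooth_on O e.
Proof.
apply: (smooth_local_fun (W := W)); apply: energy_smooth; first exact: oW.
have sL := finsler_smooth HL.
move=> j; apply: (smooth_on_sub _ (sL j)).
by move=> _ [u [ju [su _]] <-]; exists u.
Qed.
Let se := smooth_energy_chart.

Lemma energy_homogeneous z t : O z -> 0 < t ->
  e (z.1, t *: z.2) = t ^+ 2 * e z.
Proof.
move=> /coord_imageP[u Wu ->] t0; have iu : source A i u.1 := Wi Wu.
have E s : inv_chart TA i (chart A i u.1, s *: components i u.1 u.2)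
    = (u.1, s *: u.2).
  have := atlas_chartK ST (p := (u.1, s *: u.2)) iu.
  by rewrite /= (linmapZ s (linmap_components SA iu)).
have E1 : e ((chart TA i u).1, t *: (chart TA i u).2) = energy L (u.1, t *: u.2).
  exact: (congr1 (energy L) (E t)).
rewrite E1 (local_fun_chart SA Wi (energy L) Wu) /energy.
rewrite (finsler_homogeneous HL u.1 u.2 t0) -surjective_pairing.
by rewrite exprMn mulrCA.
Qed.

(** The energy is homogeneous of degree 2 in the fibre. *)
Lemma energy_euler z : O z -> 'D_(vert z.2) e z = 2 *: e z.
Proof.
move=> Oz; rewrite derive_line.
have E : \forall h \near (0 : R), e (h *: vert z.2 + z) = (1 + h) ^+ 2 * e z.
  (* homogeneity applies to the positive factor 1 + h *)
  have : \forall h \near (0 : R), -1 < h by apply: lt_nbhsr; rewrite ltrN10.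
  apply: filterS => h h1; have h0 : 0 < 1 + h by rewrite -ltrBlDl sub0r.
  apply: (etrans _ (energy_homogeneous Oz h0)).
  congr (e _); rewrite [LHS]surjective_pairing; congr (_, _).
    by rewrite /= scaler0 add0r.
  by rewrite /= scalerDl scale1r addrC.
rewrite (near_eq_derive _ E).
have D : is_derive (0 : R) 1 (fun h : R => (1 + h) ^+ 2 * e z) (2 *: e z).
  apply: is_derive_eq.
  have E0 (q : R) : (1 + 0) ^+ 2 * 0
      + q * ((1 + 0) * ((0 + 1) * 1) + (1 + 0) * (0 + 1)) = 2 * q by ring.
  exact: E0.
exact: derive_val.
Qed.

(** Vertical derivative of Euler's relation. *)
Lemma energy_euler2 z b : O z ->
  'D_(vert b) (fun y => 'D_(vert z.2) e y) z = 'D_(vert b) e z.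
Proof.
move=> Oz; have lv := @linmap_vert R V; have l2 := @linmap_snd R V V.
have [d2 e2] := l2.
have dv : differentiable (fun y : TTM => vert y.2) z by exact: diff_vert.
have P := near_eq_derive (vert b) (open_near oO Oz energy_euler).
have Q := smooth_derive_along oO (vert b) finE se Oz dv.
have S : 'D_(vert b) (fun y : TTM => vert y.2) z = vert b.
  by rewrite (derive_vert _ (d2 z)) e2.
have T : 'D_(vert b) (fun y => 2 *: e y) z = 2 *: 'D_(vert b) e z.
  exact: (derive_linmap _ (@linmap_scale R _ 2) (smooth_on_diff se Oz)).
have U := etrans (esym (etrans Q (congr1 (fun w => 'D_w e z + _) S)))
            (etrans P T).
have E (p q : R^o) : p + q = 2 *: p -> q = p.
  by move=> h; apply: (addrI p); rewrite h scaler_nat mulr2n.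
exact (E _ _ U).
Qed.

Context (G : TM -> TTM) (HG : canonical_spray A L G).

Let sG : smooth_on O (lf G).
Proof.
apply: (smooth_on_sub _ (HG.1 i)).
by move=> _ [u [iu [su _]] <-]; exists u.
Qed.

(** The equation of the canonical spray tested on vertical fields, on which only
    the x-components of G matter. *)
Lemma spray_energy z b : O z ->
  'D_(vert b) (fun y => 'D_(vert (lf G z).1) e y) z = 'D_(vert b) e z.
Proof.
move=> Oz; have [u Wu zu] := coord_imageP Oz.
pose X := const_vfield i (vert b) : TM -> TTM.
have EX y : O y -> lf X y = vert b by exact: local_const_vfield.
have dX : differentiable (lf X) z.
  by apply: (local_vfield_diff oW Oz (f := cst (vert b))).
have dG : differentiable (lf G) z by exact: smooth_on_diff sG Oz.
have H := HG.2 W X (conj oW Ws) (smooth_const_vfield SA oW Wi (vert b)) u Wu.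
rewrite zu in dX dG Oz.
have P := etrans (esym (ext_deriv_d_J SA oW Wi Wu se dG dX)) H.
have B : vderive TA X (energy L) u = 'D_(vert b) e z.
  rewrite zu; apply: (etrans (vderive_chart SA Wi X Wu (smooth_on_diff se Oz))).
  exact: (congr1 (fun w => 'D_w e _) (EX _ Oz)).
rewrite zu in B *.
have Z : 'D_(lf G (chart TA i u)) (fun y => 'D_(vert (lf X (chart TA i u)).1) e y) (chart TA i u) = 0.
  have E0 : vert (lf X (chart TA i u)).1 = 0 by exact: (congr1 (fun w : TTM => vert w.1) (EX _ Oz)).
  apply: (etrans (congr1 (fun w => 'D_(lf G (chart TA i u)) (fun y => 'D_w e y) (chart TA i u)) E0)).
  have -> : (fun y => 'D_(0 : TTM) e y) = cst 0 by apply/funext => y; exact: derive0.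
  exact: derive_cst.
have C := congr1 (fun w => 'D_w (fun y => 'D_(vert (lf G (chart TA i u)).1) e y) (chart TA i u)) (EX _ Oz).
have E (p q r s t : R^o) : p - q = - r -> p = 0 -> r = s -> q = t -> t = s.
  by move=> h hp <- <-; move: h; rewrite hp sub0r => /oppr_inj.
exact (E _ _ _ _ _ P Z B C).
Qed.

(** By the two preceding lemmas the vertical vector (0, d), where d is the
    difference of the x-components of G and y, is in the kernel of the fibre
    Hessian of the energy; being vertical it is then in the kernel of the
    two-form, and vanishes by nondegeneracy. *)
Lemma spray_is_semispray z : O z -> (lf G z).1 = z.2.
Proof.
move=> Oz; have [u Wu zu] := coord_imageP Oz.
have lb b := smooth_second_linmap oO (vert b) (@fin_dim_scalar R) se.
pose d y := (lf G y).1 - y.2.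
have lv := @linmap_vert R V.
have D0 b : 'D_(vert b) (fun y => 'D_(vert (d z)) e y) z = 0.
  have H := linmapB (lb z b Oz) (vert (lf G z).1) (vert z.2).
  have vB : vert (d z) = vert (lf G z).1 - vert z.2 by exact: (linmapB lv).
  apply: (etrans (congr1 (fun w => 'D_(vert b) (fun y => 'D_w e y) z) vB)).
  have E (p q r : R^o) : p = r -> q = r -> p - q = 0.
    by move=> -> ->; rewrite subrr.
  exact (etrans H (E _ _ _ (spray_energy b Oz) (energy_euler2 b Oz))).
pose X u := J A G u - liouville A u.
have EX y : O y -> lf X y = vert (d y).
  move=> Oy; have [w Ww yw] := coord_imageP Oy.
  have lc := linmap_components ST (Wi Ww).
  have vB : vert (d y) = vert (lf G y).1 - vert y.2 by exact: (linmapB lv).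
  rewrite vB -(local_J SA Wi G Oy) -(local_liouville SA Wi Oy) yw.
  exact (etrans (local_vfield_chart SA Wi X Ww) (etrans (linmapB lc (J A G w) (liouville A w))
    (esym (congr2 (fun p q : TTM => p - q)
      (local_vfield_chart SA Wi (J A G) Ww) (local_vfield_chart SA Wi (liouville A) Ww))))).
have sd : smooth_on O (fun y => vert (d y)).
  apply: (smooth_on_linmap_comp oO lv); apply: (smooth_onB oO).
    exact: (smooth_on_linmap_comp oO (@linmap_fst R V V) sG).
  exact: (smooth_on_linmap oO (@linmap_snd R V V)).
have slX : smooth_on O (lf X).
  by apply: (smooth_on_eq oO _ sd) => y Oy; rewrite EX.
have sX : smooth_vfield TA W X by exact: (smooth_vfield_of_local SA oW Wi slX).
have X0 : X u = 0.
  apply: (finsler_nondegenerate HL (conj oW Ws) sX Wu) => W' Y [oW' _] sY W'u.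
  have dX : differentiable (lf X) (chart TA i u).
    by apply: (smooth_on_diff slX); rewrite -zu.
  have dY : differentiable (lf Y) (chart TA i u).
    by apply: (smooth_on_diff (sY i)); exists u => //; split=> //; exact: Wi.
  have Ou : O (chart TA i u) by rewrite -zu.
  apply: (etrans (ext_deriv_d_J SA oW Wi Wu se dX dY)).
  rewrite zu in D0.
  have E0 : vert (lf X (chart TA i u)).1 = 0.
    exact: (congr1 (fun w : TTM => vert w.1) (EX _ Ou)).
  have Z : 'D_(lf Y (chart TA i u)) (fun y => 'D_(vert (lf X (chart TA i u)).1) e y) (chart TA i u) = 0.
    apply: (etrans (congr1 (fun w => 'D_(lf Y (chart TA i u)) (fun y => 'D_w e y) (chart TA i u)) E0)).
    have -> : (fun y => 'D_(0 : TTM) e y) = cst 0 by apply/funext => y; exact: derive0.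
    exact: derive_cst.
  have C : 'D_(lf X (chart TA i u)) (fun y => 'D_(vert (lf Y (chart TA i u)).1) e y) (chart TA i u) = 0.
    apply: (etrans (congr1 (fun w => 'D_w (fun y => 'D_(vert (lf Y (chart TA i u)).1) e y) (chart TA i u)) (EX _ Ou))).
    apply: (etrans _ (D0 (lf Y (chart TA i u)).1)).
    exact: (smooth_on_schwarz oO _ _ (@fin_dim_scalar R) se Ou).
  have E (p q : R^o) : p = 0 -> q = 0 -> p - q = 0.
    by move=> -> ->; rewrite subrr.
  exact (E _ _ C Z).
have := EX z Oz; rewrite {1}zu (local_vfield_chart SA Wi X Wu) X0.
rewrite (linmap_0 (linmap_components ST (Wi Wu))) => /(congr1 snd) /= /esym.
by move/eqP; rewrite subr_eq0 => /eqP.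
Qed.

End Semispray.

(** * The Douglas tensor in a chart *)

Section ProjectiveInChart.
Context (R : realType) (n : nat) (M : topologicalType) (A : atlas M 'rV[R]_n).
Hypothesis (SA : smooth_atlas A).
Local Notation V := 'rV[R]_n.
Local Notation TM := (M * 'rV[R]_n)%type.
Local Notation TTM := ('rV[R]_n * 'rV[R]_n)%type.
Local Notation TA := (tangent_atlas A).

Let finV : fin_dim V := fin_dim_rV R n.
Let finE : fin_dim TTM := fin_dim_prod finV finV.
Let ST : smooth_atlas TA := tangent_smooth_atlas finV SA.

Context (i : chart_index A) (W : set TM).
Hypotheses (oW : atlas_open TA W) (Wi : W `<=` source TA i)
  (Ws : W `<=` @slit R n M).
Local Notation O := (coord_image i W).
Let oO : open O := open_coord_image oW.
Local Notation lf := (@local_vfield R n M A i).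
Local Notation lp := (@local_pifield R n M A i).
Local Notation lfun := (@local_fun R n M A i).

Context (G : TM -> TTM) (g : TTM -> V).
Hypotheses (sg : smooth_on O g)
  (Gg : forall z, O z -> lf G z = spray_coefs g z).
Context (lambda : TM -> R).
Hypothesis (slam : smooth_fun TA W (lambda : TM -> R^o)).
Local Notation m := (lfun lambda).
Let sm : smooth_on O m. Proof. exact: smooth_local_fun slam. Qed.

Let lv := @linmap_vert R V.
Let svert (Y : TTM -> V) : smooth_on O Y -> smooth_on O (fun y => vert (Y y)).
Proof. exact: (smooth_on_linmap_comp oO lv). Qed.

Lemma local_proj_form Y y : O y ->
  lfun (proj_form A G lambda Y) y = 'D_(vert (lp Y y)) m y.
Proof.
move=> Oy; apply: (etrans (local_d_J SA Wi (beta A G Y) Oy sm)).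
exact: (congr1 (fun w : TTM => 'D_(vert w.1) m y)
  (local_beta SA oW Wi Ws sg Gg Y Oy)).
Qed.

Lemma local_berwald_gammaF X Y y : O y -> smooth_on O (lp X) -> smooth_on O (lp Y) ->
  lp (berwald A G (gammaF A X) Y) y = 'D_(vert (lp X y)) (lp Y) y.
Proof.
move=> Oy sX sY.
have EgX x : O x -> lf (gammaF A X) x = vert (lp X x) by exact: local_gammaF.
apply: (etrans (local_berwald_eq SA oW Wi Ws sg Gg Oy (svert sX) sY EgX
  (fun _ _ => erefl))).
exact: coord_berwald_vert.
Qed.

Lemma vderive_gamma X f (h : TTM -> R^o) u : W u ->
  (forall y, O y -> lfun f y = h y) -> differentiable h (chart TA i u) ->
  vderive TA (gammaF A X) f u
    = 'D_(vert (lp X (chart TA i u))) h (chart TA i u).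
Proof.
move=> Wu fh dh; apply: (etrans (vderive_local SA oW Wi (gammaF A X) Wu fh dh)).
exact: (congr1 (fun w => 'D_w h (chart TA i u))
  (local_gammaF SA Wi X (mem_coord_image Wi Wu))).
Qed.

Lemma berwald_form1_proj_form X Y u : W u ->
  smooth_on O (lp X) -> smooth_on O (lp Y) ->
  let z := chart TA i u in
  berwald_form1 A G (gammaF A X) (proj_form A G lambda) Y u
    = 'D_(vert (lp X z)) (fun y => 'D_(vert (lp Y z)) m y) z.
Proof.
move=> Wu sX sY z; have Oz : O z := mem_coord_image Wi Wu.
have dY := smooth_on_diff sY Oz.
have H y : O y -> lfun (proj_form A G lambda Y) y = 'D_(vert (lp Y y)) m y.
  exact: local_proj_form.
have P := vderive_gamma X Wu H
  (smooth_diff_along oO finE sm Oz (diff_vert dY)).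
have Q := smooth_derive_along oO (vert (lp X z)) finE sm Oz (diff_vert dY).
have S := congr1 (fun w => 'D_w m z) (derive_vert (vert (lp X z)) dY).
have T : proj_form A G lambda (berwald A G (gammaF A X) Y) u
    = 'D_(vert ('D_(vert (lp X z)) (lp Y) z)) m z.
  apply: (etrans (esym (local_fun_chart SA Wi _ Wu))).
  apply: (etrans (local_proj_form _ Oz)).
  exact: (congr1 (fun w => 'D_(vert w) m z) (local_berwald_gammaF Oz sX sY)).
have E (p q r s t : R^o) : p = q + r -> q = s -> t = s -> p - t = r.
  by move=> -> -> ->; rewrite addrAC subrr add0r.
exact (E _ _ _ _ _ (etrans P Q) S T).
Qed.

Hypothesis (Halpha : alpha_condition A G lambda).

(** The hypothesis on alpha supplies the trace of the hv-curvature on every pair of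
    local fields, without evaluating it as a trace. *)
Lemma hv_trace_chart X Y u : W u ->
  smooth_pifield A W X -> smooth_pifield A W Y ->
  let z := chart TA i u in
  hv_trace A G X Y u
    = - n.+1%:R * 'D_(vert (lp X z)) (fun y => 'D_(vert (lp Y z)) m y) z.
Proof.
move=> Wu sX sY z.
have H := Halpha (conj oW Ws) sX sY Wu.
have B := berwald_form1_proj_form Wu (smooth_local_pifield sX) (smooth_local_pifield sY).
have n0 : n.+1%:R != 0 :> R by rewrite pnatr_eq0.
have E (p q r : R) : p = - n.+1%:R^-1 * q -> p = r -> q = - n.+1%:R * r.
  by move=> + <- => ->; rewrite mulrA mulrNN mulfV // mul1r.
exact (E _ _ _ H B).
Qed.

Lemma smooth_berwald_vert X Y : smooth_pifield A W X -> smooth_pifield A W Y ->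
  smooth_pifield A W (berwald A G (gammaF A X) Y).
Proof.
move=> /(smooth_local_pifield (i := i)) sX /(smooth_local_pifield (i := i)) sY.
apply: (smooth_pifield_of_local SA oW Wi).
apply: (smooth_on_eq oO (f := fun y => 'D_(vert (lp X y)) (lp Y) y)).
  by move=> y Oy; rewrite local_berwald_gammaF.
apply: (smooth_on_along oO (p := id) finE (fun _ h => h) sY _ (svert sX)).
exact: (smooth_on_linmap oO (@linmap_id _ _)).
Qed.

(** The connection terms of the covariant derivative cancel the derivatives of X
    and Z, leaving a third vertical derivative of lambda. *)
Lemma berwald_form2_hv_trace X Y Z u : W u ->
  smooth_pifield A W X -> smooth_pifield A W Y -> smooth_pifield A W Z ->
  let z := chart TA i u in
  berwald_form2 A G (gammaF A Y) (hv_trace A G) X Z u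
    = - n.+1%:R * third_vert m (lp Z z) (lp X z) (lp Y z) z.
Proof.
move=> Wu sX sY sZ z; have Oz : O z := mem_coord_image Wi Wu.
have lX := smooth_local_pifield (i := i) sX; have lY := smooth_local_pifield (i := i) sY.
have lZ := smooth_local_pifield (i := i) sZ.
have dX := smooth_on_diff lX Oz; have dZ := smooth_on_diff lZ Oz.
pose k : R := - n.+1%:R.
pose q y := 'D_(vert (lp X y)) (fun x => 'D_(vert (lp Z y)) m x) y.
have sq : smooth_on O q.
  exact: (smooth_on_along2 oO finE sm (svert lZ) (svert lX)).
have H y : O y -> lfun (hv_trace A G X Z) y = k *: q y.
  move=> Oy; have [w Ww yw] := coord_imageP Oy.
  rewrite yw; apply: (etrans (local_fun_chart SA Wi _ Ww)).
  exact: hv_trace_chart.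
have dq := smooth_on_diff sq Oz.
have P := vderive_gamma Y Wu H (smooth_on_diff (smooth_onZ oO k sq) Oz).
have P' := derive_linmap (vert (lp Y z)) (@linmap_scale R _ k) dq.
have Q := smooth_derive_along2 oO (vert (lp Y z)) finE sm (svert lZ) (svert lX) Oz.
have T1 := hv_trace_chart Wu (smooth_berwald_vert sY sX) sZ.
have T2 := hv_trace_chart Wu sX (smooth_berwald_vert sY sZ).
have S1 := congr1 (fun w => k * 'D_(vert w) (fun y => 'D_(vert (lp Z z)) m y) z)
  (local_berwald_gammaF Oz lY lX).
have S2 := congr1 (fun w => k * 'D_(vert (lp X z)) (fun y => 'D_(vert w) m y) z)
  (local_berwald_gammaF Oz lY lZ).
have U1 := congr1 (fun w => 'D_w (fun y => 'D_(vert (lp Z z)) m y) z)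
  (derive_vert (vert (lp Y z)) dX).
have U2 := congr1 (fun w => 'D_(vert (lp X z)) (fun y => 'D_w m y) z)
  (derive_vert (vert (lp Y z)) dZ).
have E (p d t a b a' b' x y : R) : p = k * d -> d = t + b + a ->
    a = a' -> b = b' -> x = k * a' -> y = k * b' -> p - x - y = k * t.
  by move=> -> -> -> -> -> ->; ring.
exact (E _ _ _ _ _ _ _ _ _ (etrans P P') Q U1 U2 (etrans T1 S1) (etrans T2 S2)).
Qed.

Context (Gt : TM -> TTM).
Hypothesis (HGt : forall u, slit u ->
  Gt u = G u - (2 * lambda u) *: liouville A u).

(** Subtracting 2 lambda times the Liouville field from G adds lambda y to g. *)
Definition projective_coefs (y : TTM) : V := g y + m y *: y.2.

Lemma smooth_projective_coefs : smooth_on O projective_coefs.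
Proof.
apply: (smooth_onD oO sg); apply: (smooth_on_scale oO sm).
exact: (smooth_on_linmap oO (@linmap_snd R V V)).
Qed.

Lemma local_projective_spray z : O z -> lf Gt z = spray_coefs projective_coefs z.
Proof.
move=> Oz; have [u Wu zu] := coord_imageP Oz.
have lc := linmap_components ST (Wi Wu).
have E1 : lf Gt z = lf G z - (2 * m z) *: lf (liouville A) z.
  rewrite zu; apply: (etrans (local_vfield_chart SA Wi Gt Wu)).
  rewrite (HGt (Ws Wu)).
  apply: (etrans (linmapB lc _ _)).
  rewrite (local_vfield_chart SA Wi G Wu) (local_vfield_chart SA Wi (liouville A) Wu) (local_fun_chart SA Wi lambda Wu).
  by rewrite (linmapZ _ lc).
have E2 (a w : V) (s : R) : (w, - (2 *: a)) - (2 * s) *: vert w = (w, - (2 *: (a + s *: w))).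
  by rewrite -(linmapZ _ lv) pair_subv scalerDr scalerA opprD.
rewrite E1 (Gg Oz) (local_liouville SA Wi Oz); exact: E2.
Qed.

(** Both sides are the third vertical derivative of g + lambda y: on the left the
    terms in lambda come from the trace, on the right from Leibniz' rule. *)
Lemma douglas_eq_hv_curvature X Y Z u : W u ->
  smooth_pifield A W X -> smooth_pifield A W Y -> smooth_pifield A W Z ->
  douglas A G X Y Z u = hv_curvature A Gt X Y Z u.
Proof.
move=> Wu sX sY sZ.
have lX := smooth_local_pifield (i := i) sX; have lY := smooth_local_pifield (i := i) sY.
have lZ := smooth_local_pifield (i := i) sZ.
have Oz := mem_coord_image Wi Wu; set z := chart TA i u in Oz.
apply: (components_inj SA (Wi Wu : source A i u.1)).
have lc := linmap_components SA (Wi Wu : source A i u.1).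
have HVt := local_hv_curvature SA oW Wi Ws smooth_projective_coefs local_projective_spray
  Oz lX lY lZ.
have HV := local_hv_curvature SA oW Wi Ws sg Gg Oz lX lY lZ.
have TV := third_vert_projective oO (lp X z) (lp Z z) (lp Y z) sg sm Oz.
apply: (etrans _ (local_pifield_chart SA Wi (hv_curvature A Gt X Y Z) Wu)).
apply: (etrans _ (esym (etrans HVt TV))).
have cE (h x y w e : V) (k t1 t2 t3 b : R) :
  components (A := A) i u.1
    (h - k *: (t1 *: w + t2 *: x + t3 *: y) - b *: e)
  = components (A := A) i u.1 h
    - k *: (t1 *: components (A := A) i u.1 w + t2 *: components (A := A) i u.1 x
            + t3 *: components (A := A) i u.1 y)
    - b *: components (A := A) i u.1 e.
  by rewrite !(linmapB lc) !(linmapZ _ lc) !(linmapD lc) !(linmapZ _ lc).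
apply: (etrans (cE _ _ _ _ _ _ _ _ _ _)).
have n0 : n.+1%:R != 0 :> R by rewrite pnatr_eq0.
have E (h h' x x' y y' w w' e e' : V) (t1 t2 t3 b a1 a2 a3 a1' c c' : R) :
    h = h' -> x = x' -> y = y' -> w = w' -> e = e' ->
    t1 = - n.+1%:R * a1 -> t2 = - n.+1%:R * a2 -> t3 = - n.+1%:R * a3 ->
    b = - n.+1%:R * c -> a1 = a1' -> c = c' ->
    h - n.+1%:R^-1 *: (t1 *: w + t2 *: x + t3 *: y) - (n.+1%:R^-1 * b) *: e
    = h' + c' *: e' + a3 *: y' + a1' *: w' + a2 *: x'.
  move=> -> -> -> -> -> -> -> -> -> -> ->.
  have k1 (r : R) : n.+1%:R^-1 * (- n.+1%:R * r) = - r.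
    by rewrite mulrA mulrN mulVf // mulN1r.
  rewrite !scalerDr !scalerA !k1 !scaleNr !opprD !opprK !addrA.
  by rewrite (ACl (1*5*4*2*3)%AC).
have L (Y' : TM -> V) : components (A := A) i u.1 (Y' u) = lp Y' z.
  by apply/esym; exact: (local_pifield_chart SA Wi Y' Wu).
have S1 := smooth_on_schwarz oO (vert (lp Y z)) (vert (lp X z)) (@fin_dim_scalar R) sm Oz.
have S2 : third_vert m (lp Z z) (lp X z) (lp Y z) z
    = third_vert m (lp X z) (lp Z z) (lp Y z) z.
  apply: near_eq_derive; apply: (open_near oO Oz) => y Oy.
  exact: (smooth_on_schwarz oO _ _ (@fin_dim_scalar R) sm Oy).
exact (E _ _ _ _ _ _ _ _ _ _ _ _ _ _ _ _ _ _ _ _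
  (etrans (L _) HV) (L X) (L Y) (L Z) (etrans (L (@Defs.eta R n M)) (local_eta SA Wi Oz))
  (hv_trace_chart Wu sX sY) (hv_trace_chart Wu sY sZ) (hv_trace_chart Wu sZ sX)
  (berwald_form2_hv_trace Wu sX sY sZ) S1 S2).
Qed.

End ProjectiveInChart.

(** * The equivalence *)

(** The domain is shrunk to a chart around the point, where the spray has the
    form (y, - 2 g). *)
Lemma douglas_is_projective_hv_curvature (R : realType) (n : nat)
    (M : topologicalType) (A : atlas M 'rV[R]_n) (SA : smooth_atlas A)
    (L : M * 'rV[R]_n -> R) (HL : finsler A L)
    (G Gt : M * 'rV[R]_n -> 'rV[R]_n * 'rV[R]_n) (HG : canonical_spray A L G)
    (lambda : M * 'rV[R]_n -> R) (Hproj : projective_factor A G Gt lambda)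
    (Halpha : alpha_condition A G lambda)
    (W : set (M * 'rV[R]_n)) (X Y Z : M * 'rV[R]_n -> 'rV[R]_n) u :
  local_domain A W -> smooth_pifield A W X -> smooth_pifield A W Y ->
  smooth_pifield A W Z -> W u ->
  douglas A G X Y Z u = hv_curvature A Gt X Y Z u.
Proof.
move=> [oW Ws] sX sY sZ Wu; set TA := tangent_atlas A.
have ST : smooth_atlas TA := tangent_smooth_atlas (fin_dim_rV R n) SA.
pose i := chart_at TA u; pose W' := W `&` source TA i.
have oW' : atlas_open TA W'.
  exact: (atlas_open_setI ST oW (@atlas_open_source _ _ _ _ ST i)).
have Wi : W' `<=` source TA i by move=> w [].
have Ws' : W' `<=` @slit R n M by move=> w [/Ws].
have W'u : W' u by split=> //; exact: (atlas_chart_at ST u).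
have WW' : W' `<=` W by move=> w [].
have imgW j : chart TA j @` (source TA j `&` W') `<=` chart TA j @` (source TA j `&` W).
  by move=> _ [w [jw [Ww _]] <-]; exists w.
have imgS : coord_image i W' `<=` coord_image i (chart_slit i).
  by move=> _ [w [iw W'w] <-]; exists w; split=> //; split; [exact: Ws'|].
have imgS' j : chart TA j @` (source TA j `&` W')
    `<=` chart TA j @` (source TA j `&` @slit R n M).
  by move=> _ [w [jw W'w] <-]; exists w; split=> //; exact: Ws'.
have restr (Y' : M * 'rV[R]_n -> 'rV[R]_n) :
    smooth_pifield A W Y' -> smooth_pifield A W' Y'.
  by move=> sY' j; exact: (smooth_on_sub (imgW j) (sY' j)).
have [sl _ HGt] := Hproj.
have slW : smooth_fun TA W' (lambda : _ -> R^o).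
  by move=> j; exact: (smooth_on_sub (imgS' j) (sl j)).
have oO : open (coord_image i W') := open_coord_image oW'.
pose lG := local_vfield i G.
have sG : smooth_on (coord_image i W') lG.
  exact: (smooth_on_sub (imgS' i) (HG.1 i)).
pose g z := - (2^-1 *: (lG z).2).
have sg : smooth_on (coord_image i W') g.
  have s2 := smooth_on_linmap_comp oO (@linmap_snd R _ _) sG.
  exact: (smooth_onN oO (smooth_onZ oO 2^-1 s2)).
have Gg z : coord_image i W' z -> lG z = spray_coefs g z.
  move=> Oz; rewrite /spray_coefs /g scalerN opprK scalerA.
  rewrite mulfV ?pnatr_eq0 // scale1r.
  rewrite [LHS]surjective_pairing; congr (_, _).
  exact: (spray_is_semispray SA HL HG (imgS _ Oz)).
exact: (douglas_eq_hv_curvature SA oW' Wi Ws' sg Gg slW Halpha HGt W'u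
  (restr _ sX) (restr _ sY) (restr _ sZ)).
Qed.

Theorem theorem5p7 (R : realType) (n : nat) (M : topologicalType)
    (A : atlas M 'rV[R]_n) (HM : smooth_manifold A)
    (L Lt : M * 'rV[R]_n -> R) (HL : finsler A L) (HLt : finsler A Lt)
    (G Gt : M * 'rV[R]_n -> 'rV[R]_n * 'rV[R]_n)
    (HG : canonical_spray A L G) (HGt : canonical_spray A Lt Gt)
    (lambda : M * 'rV[R]_n -> R) (Hproj : projective_factor A G Gt lambda)
    (Halpha : alpha_condition A G lambda) :
  hv_curvature_vanishes A Gt <-> douglas_manifold A G.
Proof.
have D := douglas_is_projective_hv_curvature (smooth_manifold_atlas HM) HL HG
  Hproj Halpha.
split=> H W X Y Z lW sX sY sZ u Wu.
  by rewrite (D W X Y Z u lW sX sY sZ Wu); exact: (H W).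
by rewrite -(D W X Y Z u lW sX sY sZ Wu); exact: (H W).
Qed.
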